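(* For every integer $n\ge 2$, the remainder polynomial $R_{(n,2)}(x)$ is irreducible in $\mathbb{Z}[x]$.
   Context: $\mathrm{He}_k(x)$ denotes the monic probabilists' Hermite polynomial of degree $k$ (solution of $y''-xy'+ky=0$). A partition $\lambda=(\lambda_1\ge\dots\ge\lambda_r\ge 0)$ may have zero parts; its degree sequence is $n_\lambda=(\lambda_r,\lambda_{r-1}+1,\dots,\lambda_1+r-1)$, and $\Delta(x_1,\dots,x_r)=\prod_{i<j}(x_j-x_i)$. The Wronskian Hermite polynomial is $\mathrm{He}_\lambda(x)=\mathrm{Wr}[\mathrm{He}_{n_1},\dots,\mathrm{He}_{n_r}]/\Delta(n_\lambda)$ with $n_\lambda=(n_1,\dots,n_r)$; it is monic of degree $|\lambda|$ with integer coefficients. Removing a $2$-hook means replacing an entry $a$ of $n_\lambda$ by $a-2\ge 0$ with $a-2\notin n_\lambda$; removing $2$-hooks until impossible yields the $2$-core $\bar\lambda$, a staircase $(m,m-1,\dots,1)$ padded with zeros, with $|\bar\lambda|=\binom{m+1}2$. Then $\mathrm{He}_\lambda(x)=x^{|\bar\lambda|}R_\lambda(x)$ with $R_\lambda\in\mathbb{Z}[x]$, $R_\lambda(0)\neq0$ (the remainder polynomial). *)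

(* Defs.v *)
From HB Require Import structures.
From mathcomp Require Import all_boot all_order all_algebra.
Set Implicit Arguments. Unset Strict Implicit. Unset Printing Implicit Defensive.
Import Order.TTheory GRing.Theory Num.Theory.
Local Open Scope ring_scope.

(* Probabilists' Hermite polynomials over int:
   He_0 = 1, He_1 = X, He_{k+2} = X He_{k+1} - (k+1) He_k. *)
Fixpoint HeAux (k : nat) : {poly int} * {poly int} :=
  match k with
  | 0 => (1, 'X)
  | k'.+1 => let: (a, b) := HeAux k' in (b, b * 'X - a *+ k'.+1)
  end.
Definition He (k : nat) : {poly int} := (HeAux k).1.

Definition Wr (fs : seq {poly int}) : {poly int} :=
  \det (\matrix_(i < size fs, j < size fs) (derivn i (nth 0 fs j))).

(* partition la = [:: la_1; ...; la_r] (nonincreasing, zero parts allowed);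
   degree sequence n_la = (la_r, la_{r-1}+1, ..., la_1 + r - 1). *)
Definition degseq (la : seq nat) : seq nat :=
  let r := size la in [seq (nth 0 la (r - 1 - i) + i)%N | i <- iota 0 r].

Definition Delta (s : seq nat) : int :=
  \prod_(i < size s) \prod_(j < size s | (i < j)%N)
     ((nth 0%N s j)%:Z - (nth 0%N s i)%:Z).

(* Wronskian Hermite polynomial He_la = Wr[He_{n_1},...,He_{n_r}] / Delta(n_la)
   (the division is exact; performed coefficientwise in int). *)
Definition HeW (la : seq nat) : {poly int} :=
  let ns := degseq la in
  map_poly (fun c : int => (c %/ Delta ns)%Z) (Wr [seq He k | k <- ns]).

(* Removing a 2-hook from a degree sequence: replace an entry a by a-2 >= 0
   with a-2 not in the sequence (we remove the first removable entry). *)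
Definition removable2 (s : seq nat) (a : nat) : bool := (2 <= a)%N && ((a - 2)%N \notin s).
Definition hook2_step (s : seq nat) : seq nat :=
  if has (removable2 s) s then
    let a := nth 0%N s (find (removable2 s) s) in
    [seq (if b == a then b - 2 else b)%N | b <- s]
  else s.
(* Iterating until no 2-hook can be removed (each step lowers the sum by 2,
   so sumn s steps suffice). *)
Definition core2_degseq (s : seq nat) : seq nat := iter (sumn s) hook2_step s.

(* |2-core of la| = sum of the core degree sequence minus (0+1+...+(r-1)). *)
Definition core2_size (la : seq nat) : nat :=
  let b := core2_degseq (degseq la) in (sumn b - 'C(size b, 2))%N.

(* Remainder polynomial: He_la = x^{|core|} * R_la. *)
Definition Rem (la : seq nat) : {poly int} := drop_poly (core2_size la) (HeW la).

Definition irreducible_Zx (p : {poly int}) : Prop :=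
  [/\ p != 0, p \isn't a GRing.unit &
      forall a b : {poly int}, p = a * b -> a \is a GRing.unit \/ b \is a GRing.unit].

(* Main.v *)
Require Import Defs.
From mathcomp Require Import all_boot all_order all_algebra.
From mathcomp Require Import zify ring lra.
Set Implicit Arguments. Unset Strict Implicit. Unset Printing Implicit Defensive.

(** The Wronskian evaluates to [HeW (n, 2) = (X^2 + 1) He_n + 2 n He_(n-2)], which is
    [x^(odd n) Q_n(x^2)] with [Q_n] monic of degree [n/2 + 1]; [Q_n(0)], up to sign, is
    [n!!] for [n] odd and [(n + 1) (n - 3)!!] for [n] even.

    As in Schur's work on Hermite polynomials, suppose that [Q_n] has a monic factor [q] of
    degree [l], at most half the degree. The Newton polygon of [Q_n] at a prime [p > 2 l + 1]
    is too flat for [p] to divide [q(0)]. On the other hand, if [p] divides [n - n0], then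
    [Q_n] is congruent to a power of [y] times [Q_n0] modulo [p], so that [q] would divide
    [Q_n0] modulo [p]; this is impossible if [1 <> n0 <= 2 l - 3] for degree reasons, and if
    [n0 = p - 1] because [Q_n0] is then a power of [y] modulo [p]. Hence no prime [> 2 l + 1]
    divides any of [n + 1, n, n - 2, ..., n - 2 l + 3]. For large [l] this contradicts a
    Sylvester theorem on binomial coefficients, proved as by Erdos; for small [l] it leaves a
    few exponential equations in the primes [2, 3, 5, 7].

    Thus [Q_n] is irreducible, and [Q_n(x^2)] could only split as [f(x) f(-x)] up to sign.
    Then [|Q_n(0)|] would be a square, whereas it has a prime factor of multiplicity one. *)

(** * Primes and binomial coefficients *)

(** The integer [n - 1] is missing from the list because the residue [n0 = 1] has no low-degree
    model: when [n] is 1 modulo [p], the term [He (n - 2)] brings in binomials congruent to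
    [C(-1, 2j) = 1], so the coefficients do not break off early. Sylvester's theorem is therefore
    needed for a window with a hole, in the form [N = n + 1], [k = 2 l - 1], with threshold [k + 2].
    The hole costs a single factor [N - 2] in the upper bound for ['C(N, k)]. The Newton polygon is
    flat because [Q_n(0)] divides the coefficient of [y^i] times [(2 i + 1)!!], so that valuations
    drop by at most [2 i / (p - 1)] over [i] steps. For [l <= 3] the window is too short. When [n]
    is odd, the extra input is the case of equal degrees, [n0 = 2 l - 2] or [2 l - 1]: there [q] is
    congruent to [Q_n0], which fixes [q(0)] modulo [p], whereas Newton polygons leave only a few
    values for [q(0)]. *)

Definition primepi (n : nat) : nat := count prime (iota 0 n.+1).

Lemma prod_prime_const (x n : nat) :
  \prod_(0 <= p < n.+1 | prime p) x = x ^ primepi n.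
Proof. by rewrite big_const_seq /primepi /index_iota subn0 -Monoid.iteropE. Qed.

Lemma prod_primes_dvd (a b N : nat) :
  (forall p, prime p -> a <= p < b -> p %| N) ->
  \prod_(a <= p < b | prime p) p %| N.
Proof.
move=> h; have [ab|ba] := leqP a b; last by rewrite big_geq ?dvd1n // ltnW.
elim: b ab h => [|b IHb] ab h; first by rewrite big_geq ?dvd1n.
move: ab; rewrite leq_eqVlt => /orP[/eqP->|]; first by rewrite big_geq ?dvd1n.
rewrite ltnS => ab; rewrite big_mkcond big_nat_recr //= -big_mkcond /=.
have IH : \prod_(a <= p < b | prime p) p %| N.
  by apply: IHb => // p pp hp; apply: h => //; lia.
case: ifP => pb; last by rewrite muln1.
rewrite Gauss_dvd; first by rewrite IH h //; lia.
rewrite big_seq_cond; elim/big_rec: _ => [|p x]; first by rewrite coprime1n.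
rewrite mem_index_iota => /andP[/andP[_ ltpb] pp] cx.
by rewrite coprimeMl cx andbT prime_coprime // dvdn_prime2 // neq_ltn ltpb.
Qed.

(** The two middle binomials of row [m.*2.+1] are equal and both occur in the expansion of
    [(1 + 1) ^ m.*2.+1]. *)
Lemma bin_mid_le (m : nat) : 'C(m.*2.+1, m) <= 4 ^ m.
Proof.
have h : 'C(m.*2.+1, m) + 'C(m.*2.+1, m.+1) <= 2 ^ m.*2.+1.
  rewrite -[2]/(1 + 1) expnDn.
  rewrite (eq_bigr (fun i : 'I__ => 'C(m.*2.+1, i))); last first.
    by move=> i _; rewrite !exp1n !muln1.
  have lm : m < m.*2.+2 by lia.
  have lm1 : m.+1 < m.*2.+2 by lia.
  rewrite (bigD1 (Ordinal lm)) //= (bigD1 (Ordinal lm1)) /=; last first.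
    by rewrite -val_eqE /= eq_sym neq_ltn ltnSn.
  by rewrite addnA leq_addr.
have e : 'C(m.*2.+1, m.+1) = 'C(m.*2.+1, m).
  by rewrite -[LHS]bin_sub; [congr 'C(_, _); lia | lia].
move: h; rewrite e expnS -muln2 mulnC expnM.
have -> : (2 ^ 2) = 4 by []. lia.
Qed.

(** Erdos's induction: for [n = m.*2.+1] the primes in []m + 1, n]] all divide ['C(n, m)], which is
    at most [4 ^ m]. *)
Lemma primorial_le (n : nat) : \prod_(0 <= p < n.+1 | prime p) p <= 4 ^ n.
Proof.
have [k] := ubnP n; elim: k n => // k IH n; rewrite ltnS => nk.
have [n2|n2] := leqP n 2.
  case: n n2 nk => [|[|[|n]]] // _ _.
  - by rewrite big_mkcond /index_iota /= !big_cons big_nil.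
  - by rewrite big_mkcond /index_iota /= !big_cons big_nil.
  - by rewrite big_mkcond /index_iota /= !big_cons big_nil.
case on: (odd n); last first.
  rewrite big_mkcond big_nat_recr //= -big_mkcond /=.
  have -> : prime n = false.
    by apply/negP => pn; case: (even_prime pn) => h; lia.
  rewrite muln1; case: n n2 nk on => // n n2 nk on.
  by apply: (leq_trans (IH _ _)); [lia | rewrite leq_exp2l].
have [m em] : exists m, n = m.*2.+1 by exists n./2; lia.
rewrite (@big_cat_nat _ _ _ m.+2) //=; last lia.
have -> : 4 ^ n = 4 ^ m.+1 * 4 ^ m by rewrite -expnD em; congr (_ ^ _); lia.
apply: leq_mul; first by apply: IH; lia.
apply: leq_trans (bin_mid_le m); apply: dvdn_leq; first by rewrite bin_gt0; lia.
apply: prod_primes_dvd => p pp /andP[p1 p2].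
have h : p %| 'C(m.*2.+1, m) * (m`! * m.+1`!).
  have -> : m.+1 = m.*2.+1 - m by lia.
  by rewrite bin_fact; [apply: dvdn_fact; rewrite prime_gt0 //=; lia | lia].
have cf (i : nat) : i < p -> coprime p i`!.
  elim: i => [|i IHi] hi; first by rewrite coprimen1.
  rewrite factS coprimeMr IHi ?andbT; last lia.
  by rewrite prime_coprime // gtnNdvd.
by move: h; rewrite mulnC Gauss_dvdr // coprimeMr !cf //; lia.
Qed.

Lemma logn_fact_wide (p n N : nat) : prime p -> n <= N ->
  logn p n`! = \sum_(1 <= e < N.+1) n %/ p ^ e.
Proof.
move=> pp nN; rewrite logn_fact // (@big_cat_nat _ _ _ n.+1 1 N.+1) //=.
rewrite [X in _ = _ + X]big_nat_cond [X in _ = _ + X]big1 ?addn0 // => e /andP[/andP[ne _] _].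
by rewrite divn_small // (leq_trans ne) // ltnW // ltn_expl // prime_gt1.
Qed.

(** Legendre's formula. The truncated subtractions lose nothing: each summand is a carry, 0 or 1, in
    the addition of [k] and [N - k]. *)
Lemma logn_bin (p k N : nat) : prime p -> k <= N ->
  logn p 'C(N, k) = \sum_(1 <= e < N.+1) (N %/ p ^ e - k %/ p ^ e - (N - k) %/ p ^ e).
Proof.
move=> pp kN.
have h : logn p 'C(N, k) + logn p k`! + logn p (N - k)`! = logn p N`!.
  by rewrite -(bin_fact kN) !lognM ?muln_gt0 ?fact_gt0 ?bin_gt0 // addnA.
rewrite !(@logn_fact_wide p _ N) ?leq_subr // in h.
have : \sum_(1 <= e < N.+1) (N %/ p ^ e - k %/ p ^ e - (N - k) %/ p ^ e)
   + \sum_(1 <= e < N.+1) k %/ p ^ e + \sum_(1 <= e < N.+1) (N - k) %/ p ^ e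
   = \sum_(1 <= e < N.+1) N %/ p ^ e.
  rewrite -!big_split /=; apply: eq_bigr => e _.
  have pe : 0 < p ^ e by rewrite expn_gt0 prime_gt0.
  have := divnD k (N - k) pe; rewrite subnKC // => ->.
  move: (k %/ _) ((N - k) %/ _) (nat_of_bool _) => a b c; lia.
by rewrite -[X in _ = X -> _]h -!addnA => /addIn.
Qed.

(** Each exponent [e] contributes at most one carry, and none once [p ^ e] exceeds [N]. *)
Lemma expn_logn_bin_le (p k N : nat) : prime p -> k <= N -> 0 < N ->
  p ^ logn p 'C(N, k) <= N.
Proof.
move=> pp kN N0; apply: leq_trans (trunc_logP (prime_gt1 pp) N0).
rewrite leq_exp2l ?prime_gt1 // logn_bin //.
set t := trunc_log p N.
have tN : t <= N.
  by apply: leq_trans (trunc_logP (prime_gt1 pp) N0); rewrite ltnW // ltn_expl // prime_gt1.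
rewrite (@big_cat_nat _ _ _ t.+1) //= [X in _ + X]big_nat_cond [X in _ + X]big1 ?addn0.
  rewrite -[leqRHS]muln1 -[X in _ <= X * _](subnK (leq0n t)) addn0 subn0.
  have -> : t * 1 = \sum_(1 <= e < t.+1) 1 by rewrite sum_nat_const_nat subn1 /= muln1.
  apply: leq_sum => e _.
  have pe : 0 < p ^ e by rewrite expn_gt0 prime_gt0.
  have := divnD k (N - k) pe; rewrite subnKC // => ->.
  move: (k %/ _) ((N - k) %/ _) (leq_b1 (p ^ e <= k %% p ^ e + (N - k) %% p ^ e)) => a b.
  by move: (nat_of_bool _) => c; lia.
move=> e /andP[/andP[te _] _]; rewrite divn_small ?sub0n ?sub0n //.
apply: leq_trans (trunc_log_ltn N (prime_gt1 pp)) _.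
by rewrite leq_exp2l ?prime_gt1.
Qed.

Lemma logn_bin_le1 (p k N : nat) : prime p -> k <= N -> N < p ^ 2 ->
  logn p 'C(N, k) <= 1.
Proof.
move=> pp kN Np; have [/eqP N0|N0] := posnP N.
  by move: kN; rewrite (eqP N0) leqn0 => /eqP->; rewrite bin0 logn1.
rewrite -ltnS -(ltn_exp2l _ _ (prime_gt1 pp)).
exact: leq_ltn_trans (expn_logn_bin_le pp kN N0) Np.
Qed.

Lemma logn_bin_eq0 (p k N : nat) : prime p -> k <= N -> N < p ^ 2 ->
  N < 3 * p -> p <= k -> p <= N - k -> logn p 'C(N, k) = 0.
Proof.
move=> pp kN Np N3 pk pNk; rewrite logn_bin //.
apply: big1_seq => e /=; rewrite mem_index_iota => /andP[e1 _].
have [e2|e2] := leqP 2 e.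
  by rewrite divn_small ?sub0n ?sub0n //; apply: (leq_trans Np); rewrite leq_exp2l ?e2 // prime_gt1.
have -> : e = 1 by lia.
rewrite expn1.
have : N %/ p < 3 by rewrite ltn_divLR ?prime_gt0.
have : 0 < k %/ p by rewrite divn_gt0 ?prime_gt0.
have : 0 < (N - k) %/ p by rewrite divn_gt0 ?prime_gt0.
lia.
Qed.

(** * Linear bounds for the number of primes *)

Lemma count_coprime_period (x : nat) : count (coprime 210) (iota x 210) = 48.
Proof.
elim: x => [|x IH]; first by vm_compute.
have := iotaD x 1 209; have := iotaD x.+1 209 1; rewrite (addn1 x) !add1n !addn1 !addSnnS.
rewrite -[iota x 1]/[:: x] -[iota _ 1]/[:: x + 210] => -> e.
move: IH; rewrite e !count_cat; move: (count _ (iota _ 209)) => t.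
rewrite [count _ [:: x]]/= [count _ [:: x + 210]]/= !addn0.
have -> : coprime 210 (x + 210) = coprime 210 x by rewrite /coprime gcdnDr.
by rewrite addnC.
Qed.

Lemma sub_in_count (T : eqType) (a b : pred T) (s : seq T) :
  (forall x, x \in s -> a x -> b x) -> count a s <= count b s.
Proof.
elim: s => //= x s IH h; apply: leq_add.
  by case ax: (a x) => //; rewrite h ?mem_head.
by apply: IH => y ys; apply: h; rewrite inE ys orbT.
Qed.

(** Primes above 210 are prime to [210 = 2 * 3 * 5 * 7], and Euler's function takes the value 48 at
    210. *)
Lemma primepi_step (x : nat) : 210 <= x -> primepi (x + 210) <= primepi x + 48.
Proof.
move=> hx; rewrite /primepi -addSn iotaD count_cat leq_add2l add0n.
apply: leq_trans (eq_leq (count_coprime_period x.+1)).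
move: (iota x.+1 210) (fun y => mem_iota x.+1 210 y) => s hs.
apply: sub_in_count => p.
rewrite hs => /andP[xp _] pp.
rewrite coprime_sym prime_coprime //; apply/negP => /dvdn_leq; lia.
Qed.

(* [u] counts the primes below [x], and [l] lists the primality of [x], [x + 1], ... *)
Fixpoint primepi_scan (c d x u : nat) (l : seq bool) : bool :=
  if l is b :: l' then (4 * (b + u) + c <= x + d) && primepi_scan c d x.+1 (b + u) l' else true.

Lemma primepi_scanP (c d x : nat) (l : seq nat) :
  path (fun a b => b == a.+1) x l ->
  primepi_scan c d x.+1 (primepi x) (map prime l) ->
  forall y, y \in l -> 4 * primepi y + c <= y + d.
Proof.
elim: l x => // z l IH x /= /andP[/eqP-> hp] /andP[h1 h2] y.
have e : prime x.+1 + primepi x = primepi x.+1.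
  by rewrite /primepi -[x.+2]addn1 iotaD count_cat /= addn0 addnC.
rewrite inE => /orP[/eqP->|yl]; first by rewrite -e.
by apply: (IH x.+1) => //; rewrite -e.
Qed.

Lemma path_iota (x n : nat) : path (fun a b => b == a.+1) x (iota x.+1 n).
Proof. by elim: n x => //= n IH x; rewrite eqxx IH. Qed.

(** Since [4 * 48 <= 210], the quantity [4 * primepi x - x] does not increase from [x] to [x + 210],
    so one period of verified values suffices. *)
Lemma primepi_linear (c d x0 : nat) : 210 <= x0 ->
  primepi_scan c d x0.+1 (primepi x0) (map prime (iota x0.+1 210)) ->
  forall x, x0 < x -> 4 * primepi x + c <= x + d.
Proof.
move=> h0 /(primepi_scanP (path_iota _ _)) hb x.
have [k] := ubnP x; elim: k x => // k IH x; rewrite ltnS => xk hx.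
have [hl|hl] := ltnP x (x0.+1 + 210); first by apply: hb; rewrite mem_iota hx.
have h1 : 4 * primepi (x - 210) + c <= (x - 210) + d by apply: IH; lia.
have := @primepi_step (x - 210); rewrite subnK; last lia.
move: (primepi x) (primepi _) h1 => a b h1 h2; have := h2 ltac:(lia); lia.
Qed.

(** The constant 13 is attained, for instance at [x = 19]. *)
Lemma primepi_le (x : nat) : 4 * primepi x <= x + 13.
Proof.
rewrite -[leqLHS]addn0; have [hx|hx] := ltnP 210 x.
  apply: (@primepi_linear 0 13 210 _ _ x hx); first exact: leqnn.
  by vm_compute.
case: x hx => // x hx.
have h : primepi_scan 0 13 1 (primepi 0) (map prime (iota 1 210)) by vm_compute.
by apply: (primepi_scanP (path_iota _ _) h); rewrite mem_iota.
Qed.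

(** Tailored to [x = k + 2] with [k > 256], where it reads [4 * (primepi (k + 2) + 1) <= k]. *)
Lemma primepi_lt (x : nat) : 259 <= x -> 4 * primepi x + 6 <= x.
Proof.
move=> hx; rewrite -[leqRHS]addn0.
apply: (@primepi_linear 6 0 258 _ _ x hx); by vm_compute.
Qed.

(** * Lower bounds for binomial coefficients, upper bounds from smoothness *)

Lemma bin_ratio (M N k : nat) : k <= M -> M <= N ->
  'C(M, k) * N ^ k <= 'C(N, k) * M ^ k.
Proof.
move=> kM MN; rewrite -(leq_pmul2l (fact_gt0 k)) !mulnA ![k`! * _]mulnC !bin_ffact.
have pow x : x ^ k = \prod_(i < k) x by rewrite prod_nat_const card_ord.
(* Factor by factor, [(M - i) / M <= (N - i) / N]. *)
rewrite !ffact_prod !pow -!big_split /=; apply: leq_prod => i _.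
rewrite !mulnBl (mulnC N M); apply: leq_sub2l; rewrite leq_mul2l; lia.
Qed.

Lemma bin_central (k : nat) : 0 < k -> 4 ^ k <= k.*2 * 'C(k.*2, k).
Proof.
elim: k => // k IH _; have [->|k0] := posnP k; first by rewrite bin1.
have h := IH k0.
have e1 : k.+1 * 'C(k.*2.+2, k.+1) = k.*2.+2 * 'C(k.*2.+1, k) by rewrite mul_bin_diag.
have e2 : k.+1 * 'C(k.*2.+1, k) = k.*2.+1 * 'C(k.*2, k).
  by have := mul_bin_down k.*2.+1 k; have -> : k.*2.+1 - k = k.+1 by lia.
rewrite doubleS expnS.
have : k.+1.*2 * 'C(k.*2.+2, k.+1) = 2 * (2 * (k.*2.+1 * 'C(k.*2, k))).
  by rewrite -e2 -mul2n -mulnA e1; lia.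
rewrite -doubleS => ->; nia.
Qed.

Lemma expn_le_bin (k N : nat) : k <= N -> N ^ k <= 'C(N, k) * k ^ k.
Proof. by move=> kN; have := bin_ratio (leqnn k) kN; rewrite binn mul1n. Qed.

Lemma expn_le_bin_central (k N : nat) : 0 < k -> k.*2 <= N ->
  4 ^ k * N ^ k <= k.*2 * k.*2 ^ k * 'C(N, k).
Proof.
move=> k0 kN; apply: (@leq_trans (k.*2 * 'C(k.*2, k) * N ^ k)).
  by rewrite leq_mul2r bin_central ?orbT.
rewrite -!mulnA leq_mul2l [_ * 'C(N, k)]mulnC bin_ratio ?orbT //; lia.
Qed.

(** For [N = n + 1] and [k = 2 l - 1] the window is [n - 2 l + 3, ..., n + 1], the hole [N - 2] is
    [n - 1], and [k + 2] is [2 l + 1]. *)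
Definition smooth_window (k N : nat) : Prop :=
  forall p i, prime p -> N - k < i <= N -> i != N - 2 -> p %| i -> p <= k + 2.

(** The part of ['C(N, k)] built from primes above [k + 2] divides that of
    [N (N - 1) ... (N - k + 1)], where only the factor [N - 2] can contribute. *)
Lemma bin_smooth_bound (k N : nat) : k <= N -> 2 < N -> smooth_window k N ->
  'C(N, k) <= (N - 2) * \prod_(0 <= p < k.+3 | prime p) p ^ logn p 'C(N, k).
Proof.
move=> kN N2 H; set C := 'C(N, k).
pose pi : nat_pred := [pred p | p <= k + 2].
have C0 : 0 < C by rewrite bin_gt0.
rewrite -[leqLHS](partnC pi C0) mulnC; apply: leq_mul.
  have h : C`_pi^' %| (N ^_ k)`_pi^'.
    by apply: partn_dvd; [rewrite ffact_gt0 | rewrite -bin_ffact dvdn_mulr].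
  have hj j : j <= k -> (N ^_ j)`_pi^' <= if j <= 2 then 1 else N - 2.
    elim: j => [|j IHj] jk; first by rewrite ffactn0 partn1.
    rewrite ffactnSr partnM ?ffact_gt0; try lia.
    have [ej|j2] := eqVneq j 2.
      move: IHj jk; rewrite ej /= => IHj jk; rewrite -[leqRHS]mul1n.
      by apply: leq_mul; [apply: IHj; lia | apply: dvdn_leq; [lia | apply: dvdn_part]].
    have -> : (N - j)`_pi^' = 1.
      apply: part_p'nat; rewrite pnatNK; apply/pnatP; first lia.
      move=> p pp pd; rewrite inE; apply: H pp _ _ pd; lia.
    rewrite muln1; apply: leq_trans (IHj _) _; first lia.
    by case: ifP; case: ifP; lia.
  apply: leq_trans (dvdn_leq _ h) _; first by rewrite part_gt0.
  by apply: leq_trans (hj k _) _ => //; case: ifP; lia.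
have hx : C <= C + k.+2 by lia.
rewrite (widen_partn _ hx) (@big_cat_nat _ _ _ k.+3) //=; last lia.
rewrite [X in _ * X]big_nat_cond [X in _ * X]big1 ?muln1; last first.
  by move=> p /andP[/andP[h1 _]]; rewrite inE; lia.
rewrite big_nat_cond [leqRHS]big_nat_cond big_mkcond [leqRHS]big_mkcond /=.
apply: leq_prod => p _; rewrite !inE addn2 ltnS andbb; case: (leqP p k.+2) => //= _.
by case: ifP => // np; rewrite lognE np.
Qed.

Lemma prod_prime_pow_le (k N : nat) : k <= N -> 0 < N ->
  \prod_(0 <= p < k.+3 | prime p) p ^ logn p 'C(N, k) <= N ^ primepi k.+2.
Proof.
move=> kN N0; rewrite -prod_prime_const; apply: leq_prod => p pp.
exact: expn_logn_bin_le.
Qed.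

Lemma prod_prime_trunc (F : nat -> nat) (a s : nat) :
  (forall p, prime p -> 0 < F p) ->
  \prod_(0 <= p < a | prime p) (if p <= s then F p else 1)
    <= \prod_(0 <= p < s.+1 | prime p) F p.
Proof.
move=> F0; have [h|h] := leqP a s.+1.
  rewrite [leqRHS](@big_cat_nat _ _ _ a) //= -[leqLHS]muln1; apply: leq_mul.
    by apply: leq_prod => p pp; case: ifP => // _; apply: F0.
  by rewrite prodn_cond_gt0.
rewrite (@big_cat_nat _ _ _ s.+1) //=; last by rewrite ltnW.
rewrite [X in _ * X]big_nat_cond [X in _ * X]big1 ?muln1; last first.
  by move=> p /andP[/andP[sp _] _]; rewrite leqNgt sp.
rewrite big_nat_cond [leqRHS]big_nat_cond; apply: leq_prod => p.
by rewrite ltnS => /andP[/andP[_ ->]].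
Qed.

(* A prime in ]N/3, k] divides N!, k! and (N - k)! to the powers 2, 1, 1, hence not 'C(N, k). *)
Lemma prod_prime_pow_le_sqrt (k N s X : nat) :
  odd k -> 1 < k -> k.*2 < N -> N < s.+1 ^ 2 -> (k.+2 <= X) || (N < 3 * X.+1) ->
  \prod_(0 <= p < k.+3 | prime p) p ^ logn p 'C(N, k) <= N ^ primepi s * 4 ^ X * N.
Proof.
move=> ok k1 kN Ns hX.
pose A p := if p <= s then N else 1.
pose B p := if p <= X then p else 1.
(* As [k.+1] is even, [k.+2] is the only prime of the range that can exceed [k]; it gets the crude
   bound [N]. *)
pose D p := if p == k.+2 then N else 1.
have N0 : 0 < N by lia.
have kN' : k <= N by lia.
apply: (@leq_trans (\prod_(0 <= p < k.+3 | prime p) (A p * B p * D p))).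
  rewrite big_nat_cond [leqRHS]big_nat_cond; apply: leq_prod => p /andP[pk pp].
  have p0 := prime_gt0 pp.
  have hB : 0 < B p by rewrite /B; case: ifP.
  have hD : 0 < D p by rewrite /D; case: ifP.
  rewrite /A; case: (leqP p s) => ps.
    rewrite -mulnA; apply: leq_trans (leq_pmulr _ _); last by rewrite muln_gt0 hB.
    exact: expn_logn_bin_le.
  rewrite mul1n; have Np : N < p ^ 2 by apply: leq_trans Ns _; rewrite leq_exp2r.
  rewrite /D; case: eqP => pk2.
    apply: leq_trans (leq_pmull _ hB); exact: expn_logn_bin_le.
  rewrite muln1 /B; case: (leqP p X) => pX.
    by rewrite -[leqRHS]expn1 leq_exp2l ?prime_gt1 // logn_bin_le1.
  rewrite logn_bin_eq0 //; try lia.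
  by case: (even_prime pp) => ?; lia.
rewrite !big_split /=; apply: leq_mul; first apply: leq_mul.
- by rewrite -prod_prime_const; apply: (@prod_prime_trunc (fun=> N)).
- by apply: leq_trans (primorial_le X); apply: prod_prime_trunc => p /prime_gt0.
rewrite big_mkcond big_nat_recr //= big_nat_cond big1; last first.
  by move=> p /andP[/andP[_ h] _]; rewrite /D; case: eqP => [e|]; [lia | case: ifP].
by rewrite mul1n /D eqxx; case: ifP.
Qed.

(** * Prime factors in a window of consecutive integers *)

(** The farthest prime within distance 46, not the nearest one, so that 96 jumps lead from 53 past
    4096; the default is [p] itself. *)
Definition next_prime (p : nat) : nat := last p [seq q <- iota p.+1 46 | prime q].

Lemma next_primeP (p : nat) : prime p ->
  [/\ prime (next_prime p), p <= next_prime p & next_prime p <= p + 46].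
Proof.
move=> pp; rewrite /next_prime.
move: (iota p.+1 46) (fun y => mem_iota p.+1 46 y) => s hs.
have := mem_last p [seq q <- s | prime q]; move: (last _ _) => r.
rewrite inE => /orP[/eqP->|]; first by rewrite pp leqnn leq_addr.
rewrite mem_filter hs => /andP[-> /andP[pr rp]].
by rewrite (ltnW pr); split => //; rewrite -ltnS -addSn.
Qed.

Lemma prime_gap_iter (n p x : nat) : prime p -> p <= x < iter n next_prime p ->
  exists2 q, prime q & q <= x < q + 46.
Proof.
elim: n p => [|n IH] p pp; rewrite ?iterSr /=; first by lia.
have [qp pq qp46] := next_primeP pp.
move=> hx; have [h|h] := ltnP x (next_prime p); first by exists p => //; lia.
by apply: (IH _ qp); rewrite h; case/andP: hx.
Qed.

Lemma prime_gap (x : nat) : 53 <= x < 4096 -> exists2 q, prime q & q <= x < q + 46.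
Proof.
have p53 : prime 53 by vm_compute.
have key := fun n => @prime_gap_iter n 53 x p53.
have h : 4096 <= iter 96 next_prime 53 by vm_compute.
move: (iter 96 _ _) h (key 96) => r h {}key hx; apply: key.
by move: hx => /andP[-> hx]; apply: leq_trans hx h.
Qed.

(* [l] lists, from some index on, whether an integer has a prime factor [> k + 2]; the
   first [k] entries form a window whose entry [k - 3] has to be disregarded. *)
Definition window_hit (k : nat) (l : seq bool) : bool :=
  [|| has id (take (k - 3) l), nth false l (k - 2) | nth false l (k - 1)].

Fixpoint scan_windows (k n : nat) (l : seq bool) : bool :=
  if n is n'.+1 then window_hit k l && scan_windows k n' (behead l) else true.

Lemma scan_windowsP (k n j : nat) (l : seq bool) :
  scan_windows k n l -> j < n -> window_hit k (drop j l).
Proof.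
elim: n j l => // n IH [|j] l /= /andP[h1 h2] jn; first by rewrite drop0.
by rewrite -addn1 -drop_drop drop1; apply: IH.
Qed.

Lemma window_hitP (k j : nat) (l : seq bool) : 3 < k -> window_hit k (drop j l) ->
  exists2 i, i < k & (i != k - 3) && nth false l (j + i).
Proof.
move=> k3 /or3P[|h|h]; last 2 first.
- by exists (k - 2); [lia | rewrite -nth_drop h andbT; lia].
- by exists (k - 1); [lia | rewrite -nth_drop h andbT; lia].
move=> /(has_nthP false)[i]; rewrite size_take_min => hi.
rewrite nth_take ?nth_drop => [h|]; last lia.
by exists i; [lia | rewrite h andbT; lia].
Qed.

(** The least admissible [N] is [k.*2.+1], whose window starts at [k + 2]; the number of windows
    brings [N] up to 2047. *)
Definition scan_gpf (t : seq nat) (k : nat) : bool :=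
  scan_windows k (2048 - k.*2.+1) (drop (k + 2) [seq k + 2 < g | g <- t]).

Definition scan_gpf_all (t : seq nat) : bool :=
  all (fun k => ~~ odd k || scan_gpf t k) (iota 7 43).

Lemma scan_gpf_allP (t : seq nat) (k : nat) :
  scan_gpf_all t -> odd k -> 7 <= k < 50 -> scan_gpf t k.
Proof. by move=> /allP/(_ k) h ok hk; move: h; rewrite mem_iota ok; apply. Qed.

Lemma scan_gpf_small : scan_gpf_all (map max_pdiv (iota 0 2048)).
Proof. by vm_compute. Qed.

Lemma not_smooth_window_small (k N : nat) :
  odd k -> 7 <= k < 50 -> k.*2 < N < 2048 -> ~ smooth_window k N.
Proof.
move=> ok hk hN H.
have h := scan_gpf_allP scan_gpf_small ok hk.
have jn : N - k.*2.+1 < 2048 - k.*2.+1.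
  by case/andP: hN => h1 h2; apply: ltn_sub2r; first exact: leq_ltn_trans h1 h2.
have := scan_windowsP h jn; rewrite drop_drop => {}h.
have [|i ik /andP[i3]] := window_hitP _ h; first by case/andP: hk => /ltnW/ltnW/ltnW.
have [hi|hi] := ltnP (N - k.*2.+1 + (k + 2) + i) 2048; last first.
  by rewrite nth_default // size_map size_map size_iota.
rewrite (nth_map 0) ?size_map ?size_iota // (nth_map 0) ?size_iota // nth_iota // add0n.
set x := (_ + i)%N => hx; suff : max_pdiv x <= k + 2 by rewrite leqNgt hx.
apply: (H _ x); [apply: max_pdiv_prime | | | exact: max_pdiv_dvd]; lia.
Qed.

(** Compares [(N / k) ^ k <= 'C(N, k)] with the bound [(N - 2) * N ^ primepi k.+2] given by
    smoothness. *)
Lemma smooth_window_pow_lt (k N : nat) : 0 < k -> k <= N -> 2 < N -> smooth_window k N ->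
  N ^ k < N ^ (primepi k.+2).+1 * k ^ k.
Proof.
move=> k0 kN N2 H; have N0 : 0 < N by lia.
apply: leq_ltn_trans (expn_le_bin kN) _; rewrite ltn_pmul2r ?expn_gt0 ?k0 //.
apply: leq_ltn_trans (bin_smooth_bound kN N2 H) _; rewrite expnS.
apply: leq_ltn_trans (leq_mul (leqnn _) (prod_prime_pow_le kN N0)) _.
by rewrite ltn_pmul2r ?expn_gt0 ?N0 //; lia.
Qed.

Lemma smooth_window_expn_lt (k N a : nat) : 0 < k -> k <= N -> 2 < N -> smooth_window k N ->
  a + primepi k.+2 < k -> N ^ a < k ^ k.
Proof.
move=> k0 kN N2 H ha; have N0 : 0 < N by lia.
have := smooth_window_pow_lt k0 kN N2 H.
have [b eb] : exists b, k = (primepi k.+2).+1 + b by exists (k - (primepi k.+2).+1); lia.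
rewrite [X in N ^ X < _]eb expnD ltn_pmul2l ?expn_gt0 ?N0 //.
by apply: leq_ltn_trans; rewrite leq_exp2l //; lia.
Qed.

(** Certifies [k ^ k <= (2 ^ 11) ^ a] for [a = k - (primepi k.+2).+1] through integer logarithms.
    Cubing refines the rounding of [up_log] to thirds, and [33 = 3 * 11]. *)
Definition cube_log_check : bool :=
  all (fun k => ~~ odd k || [&& primepi k.+2 < k & up_log 2 (k ^ 3) * k <= 33 * (k - (primepi k.+2).+1)])
      (iota 7 43).

Lemma cube_log_check_true : cube_log_check.
Proof. by vm_compute. Qed.

Lemma not_smooth_window_medium (k N : nat) :
  odd k -> 7 <= k < 50 -> k.*2 < N -> ~ smooth_window k N.
Proof.
move=> ok hk kN; have [N2|N2] := ltnP N 2048.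
  by apply: not_smooth_window_small; rewrite ?kN.
move=> H; have h : forall k, odd k -> 7 <= k < 50 ->
  primepi k.+2 < k /\ up_log 2 (k ^ 3) * k <= 33 * (k - (primepi k.+2).+1).
  move=> {hk H kN}k {}ok hk; move: cube_log_check_true => /allP/(_ k).
  by rewrite mem_iota ok => /(_ hk) /andP.
have [h1 h2] := h k ok hk.
set a := k - (primepi k.+2).+1 in h2.
have N2' : 2 ^ 11 <= N by [].
have : N ^ a < k ^ k by apply: smooth_window_expn_lt => //; rewrite /a; lia.
rewrite ltnNge => /negP; apply.
have k0 : 0 < k by lia.
rewrite -(@leq_exp2r _ _ 3) // -!expnM [k * 3]mulnC expnM.
apply: (@leq_trans ((2 ^ up_log 2 (k ^ 3)) ^ k)); first by rewrite leq_exp2r // up_logP.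
rewrite -expnM; apply: leq_trans (leq_pexp2l _ h2) _ => //.
have -> : 33 * a = 11 * (a * 3) by lia.
rewrite expnM leq_exp2r //; rewrite muln_gt0 andbT; apply/negPn/negP.
rewrite -leqNgt leqn0 => /eqP a0; move: h2; rewrite a0 muln0 leqn0 muln_eq0.
rewrite up_log_eq0 /= -[1]/(1 ^ 3) leq_exp2r //; lia.
Qed.

Lemma dyadic_bound (s : nat) : 64 <= s -> exists j, [/\ s < 2 ^ j, 7 * j <= s & j ^ 2 <= s].
Proof.
move=> hs; exists (trunc_log 2 s).+1; set t := trunc_log 2 s.
have t6 : 6 <= t by apply: trunc_log_max.
have h1 : 2 ^ t <= s by apply: trunc_logP => //; lia.
have h : 7 * t.+1 <= 2 ^ t /\ t.+1 ^ 2 <= 2 ^ t.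
  move: t t6 {h1}; elim=> // t IH; rewrite leq_eqVlt => /orP[/eqP[<-] //|t6].
  have [i1 i2] := IH t6; rewrite expnS; split; nia.
split; [exact: trunc_log_ltn | lia | lia].
Qed.

Lemma sqrt_exists (N : nat) : exists s, s ^ 2 <= N < s.+1 ^ 2.
Proof.
elim: N => [|N [s /andP[h1 h2]]]; first by exists 0.
have [h|h] := ltnP N.+1 (s.+1 ^ 2); first by exists s; lia.
by exists s.+1; rewrite h /=; nia.
Qed.

Lemma smooth_window_bin_lt (k N s X : nat) :
  odd k -> 1 < k -> k.*2 < N -> smooth_window k N -> N < s.+1 ^ 2 ->
  (k.+2 <= X) || (N < 3 * X.+1) -> 'C(N, k) < N ^ (primepi s + 2) * 4 ^ X.
Proof.
move=> ok k1 kN H Ns hX.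
have N0 : 0 < N by lia.
have kN' : k <= N by lia.
apply: leq_ltn_trans (bin_smooth_bound kN' _ H) _; first lia.
apply: leq_ltn_trans (leq_mul (leqnn _) (prod_prime_pow_le_sqrt ok k1 kN Ns hX)) _.
have -> : N ^ (primepi s + 2) * 4 ^ X = N * (N ^ primepi s * 4 ^ X * N).
  by rewrite addn2 !expnS; lia.
by rewrite ltn_pmul2r ?muln_gt0 ?expn_gt0 ?N0 //; lia.
Qed.

(** A rational lower bound, 2.3, for the binary logarithm of 5. The powers are split so that no
    large unary numeral is computed. *)
Lemma pow2_23_le : 2 ^ 23 <= 5 ^ 10.
Proof.
rewrite -[23]/(11 + 12) -[10]/(5 + 5) !expnD.
have -> : 2 ^ 11 = 2048 by vm_compute.
have -> : 2 ^ 12 = 4096 by vm_compute.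
have -> : 5 ^ 5 = 3125 by vm_compute.
lia.
Qed.

Lemma pow_N_lt (N s j e : nat) : 0 < e -> N < s.+1 ^ 2 -> s < 2 ^ j -> N ^ e < 2 ^ (2 * j * e).
Proof.
move=> e0 Ns sj; rewrite expnM ltn_exp2r // mulnC expnM.
by apply: leq_trans Ns _; rewrite leq_exp2r.
Qed.

(* The four ranges [N <= 5k/2], [5k/2 < N <= 3k], [3k < N <= 4k], [4k < N] lose
   respectively the factors [4 ^ (N / 3)], [4 ^ k], [4 ^ (k + 2)], [4 ^ (k + 2)] against
   the lower bound [(2 N / k) ^ k] for the binomial coefficient. *)
Lemma not_smooth_window_large (k N : nat) :
  odd k -> 50 < k -> k.*2 < N -> 4096 <= N -> N ^ 3 < k ^ 4 -> ~ smooth_window k N.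
Proof.
move=> ok hk kN hN Nk H; have [s /andP[s1 s2]] := sqrt_exists N.
have s64 : 64 <= s.
  rewrite leqNgt; apply/negP => hs.
  have : s.+1 ^ 2 <= 64 ^ 2 by rewrite leq_exp2r.
  by rewrite leqNgt => /negP; apply; apply: leq_ltn_trans s2; apply: leq_trans hN.
have [j [sj j7 j2]] := dyadic_bound s64.
have pis := primepi_le s; set u := primepi s in pis.
have k1 : 1 < k by lia.
have k0 : 0 < k by lia.
have N0 : 0 < N by lia.
have low : 4 ^ k * N ^ k <= N * k.*2 ^ k * 'C(N, k).
  apply: leq_trans (expn_le_bin_central k0 (ltnW kN)) _.
  by rewrite !leq_mul2r (ltnW kN) !orbT.
have up X : (k.+2 <= X) || (N < 3 * X.+1) -> N * 'C(N, k) < N ^ (u + 3) * 4 ^ X.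
  move=> hX; have := smooth_window_bin_lt ok k1 kN H s2 hX.
  rewrite -/u [u + 3]addnS expnS -mulnA ltn_pmul2l //.
have js : 7 * (j * (s + 25)) <= s * (s + 25) by rewrite mulnA leq_mul2r j7 orbT.
have ju : j * (4 * (u + 3)) <= j * (s + 25) by rewrite leq_mul2l; apply/orP; right; lia.
have ss : 64 * s <= s ^ 2 by rewrite expnS expn1 leq_mul2r s64 orbT.
have powN e : 0 < e -> N ^ e < 2 ^ (2 * j * e) by move=> e0; apply: pow_N_lt sj.
have four x : 4 ^ x = 2 ^ (2 * x) by rewrite expnM.
have [r1|r1] := leqP (2 * N) (5 * k).
  have h1 : 4 ^ k <= N * 'C(N, k).
    rewrite -(@leq_pmul2r (k.*2 ^ k)) ?expn_gt0 ?double_gt0 ?k0 //.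
    apply: leq_trans (_ : _ <= 4 ^ k * N ^ k) _; first by rewrite leq_mul2l leq_exp2r // ltnW ?orbT.
    by apply: leq_trans low _; rewrite mulnAC.
  have hX : (k.+2 <= N %/ 3) || (N < 3 * (N %/ 3).+1) by rewrite mulnC -ltn_divLR ?ltnSn ?orbT.
  have h2 := leq_ltn_trans h1 (up _ hX).
  (* Here [N / 3 <= 5 k / 6]; sixth powers clear the denominator. *)
  have h3 : 4 ^ (6 * k) < N ^ (6 * (u + 3)) * 4 ^ (5 * k).
    rewrite [6 * k]mulnC [6 * (u + 3)]mulnC !expnM.
    apply: (@leq_trans ((N ^ (u + 3) * 4 ^ (N %/ 3)) ^ 6)); first by rewrite ltn_exp2r.
    rewrite expnMn leq_mul2l -!expnM leq_exp2l //; apply/orP; right.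
    have := leq_divM N 3; lia.
  have h4 : 4 ^ k < N ^ (6 * (u + 3)).
    move: h3; have -> : 6 * k = k + 5 * k by lia.
    by rewrite expnD ltn_pmul2r ?expn_gt0.
  have := ltn_trans h4 (powN (6 * (u + 3)) ltac:(lia)); rewrite four ltn_exp2l // => h5.
  by move: ju ss js h5; move: (u + 3) => v; lia.
have [r2|r2] := leqP N (3 * k).
  have h1 : 5 ^ k <= N * 'C(N, k).
    rewrite -(@leq_pmul2r (k ^ k * 4 ^ k)) ?muln_gt0 ?expn_gt0 ?k0 //.
    apply: (@leq_trans (4 ^ k * N ^ k * 2 ^ k)).
      have -> : 5 ^ k * (k ^ k * 4 ^ k) = (5 * k) ^ k * 4 ^ k by rewrite expnMn mulnA.
      have -> : 4 ^ k * N ^ k * 2 ^ k = (2 * N) ^ k * 4 ^ k by rewrite expnMn; lia.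
      by rewrite leq_mul2r leq_exp2r // ltnW ?orbT.
    apply: leq_trans (leq_mul low (leqnn _)) _.
    rewrite -mul2n expnMn; have -> : 4 ^ k = 2 ^ k * 2 ^ k by rewrite -expnMn.
    by apply: eq_leq; lia.
  have hX : (k.+2 <= k) || (N < 3 * k.+1) by lia.
  have h2 := leq_ltn_trans h1 (up _ hX).
  (* Tenth powers make the gap between 5 and 4 visible in powers of two: [5 ^ 10 >= 2 ^ 23] against
     [4 ^ 10 = 2 ^ 20]. *)
  have h3 : 2 ^ (23 * k) < N ^ (10 * (u + 3)) * 2 ^ (20 * k).
    apply: (@leq_ltn_trans ((5 ^ k) ^ 10)).
      rewrite -expnM [k * 10]mulnC !expnM; move: (2 ^ 23) (5 ^ 10) pow2_23_le => x y xy.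
      by rewrite leq_exp2r.
    apply: (@leq_trans ((N ^ (u + 3) * 4 ^ k) ^ 10)); first by rewrite ltn_exp2r.
    by rewrite expnMn -!expnM [(u + 3) * 10]mulnC four; apply: eq_leq; congr (_ * 2 ^ _); lia.
  have h4 : 2 ^ (3 * k) < N ^ (10 * (u + 3)).
    move: h3; have -> : 23 * k = 3 * k + 20 * k by lia.
    by rewrite expnD ltn_pmul2r ?expn_gt0.
  have := ltn_trans h4 (powN (10 * (u + 3)) ltac:(lia)); rewrite ltn_exp2l // => h5.
  by move: ju ss js h5; move: (u + 3) => v; lia.
have hX : (k.+2 <= k.+2) || (N < 3 * k.+3) by rewrite leqnn.
have up' : N * 'C(N, k) < N ^ (u + 4) * 4 ^ k.
  apply: leq_trans (up _ hX) _; rewrite [u + 4]addnS (expnS N) !(expnS 4).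
  have : 16 * (N ^ (u + 3) * 4 ^ k) <= N * (N ^ (u + 3) * 4 ^ k) by rewrite leq_mul2r; lia.
  lia.
have [r3|r3] := leqP N (4 * k).
  have h1 : 6 ^ k <= N * 'C(N, k).
    rewrite -(@leq_pmul2r (k.*2 ^ k)) ?expn_gt0 ?double_gt0 ?k0 //.
    apply: (@leq_trans (4 ^ k * N ^ k)); first by rewrite -!expnMn leq_exp2r //; lia.
    by apply: leq_trans low _; rewrite mulnAC.
  have h2 := leq_ltn_trans h1 up'.
  have h3 : 2 ^ (5 * k) < N ^ (2 * (u + 4)) * 2 ^ (4 * k).
    apply: (@leq_ltn_trans ((6 ^ k) ^ 2)).
      by rewrite -expnM [k * 2]mulnC !expnM leq_exp2r.
    apply: (@leq_trans ((N ^ (u + 4) * 4 ^ k) ^ 2)); first by rewrite ltn_exp2r.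
    by rewrite expnMn -!expnM [(u + 4) * 2]mulnC four; apply: eq_leq; congr (_ * 2 ^ _); lia.
  have h4 : 2 ^ k < N ^ (2 * (u + 4)).
    move: h3; have -> : 5 * k = k + 4 * k by lia.
    by rewrite expnD ltn_pmul2r ?expn_gt0.
  have := ltn_trans h4 (powN (2 * (u + 4)) ltac:(lia)); rewrite ltn_exp2l // => h5.
  by move: ju ss js h5; lia.
have h1 : 8 ^ k <= N * 'C(N, k).
  rewrite -(@leq_pmul2r (k.*2 ^ k)) ?expn_gt0 ?double_gt0 ?k0 //.
  apply: (@leq_trans (4 ^ k * N ^ k)); first by rewrite -!expnMn leq_exp2r //; lia.
  by apply: leq_trans low _; rewrite mulnAC.
have h2 := leq_ltn_trans h1 up'.
have h4 : 2 ^ k < N ^ (u + 4).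
  by move: h2; rewrite -[8]/(2 * 4) expnMn ltn_pmul2r ?expn_gt0.
have := ltn_trans h4 (powN (u + 4) ltac:(lia)); rewrite ltn_exp2l // => h5.
(* In this range only [N ^ 3 < k ^ 4] relates [N] to [k] from above. With [j ^ 2 <= s] it gives
   [4 s ^ 3 < s (s + 29) ^ 2], hence [s < 29]. *)
have h6 : s ^ 3 < k ^ 2.
  rewrite -(@ltn_exp2r _ _ 2) // -!expnM; apply: leq_ltn_trans Nk.
  by rewrite -[3 * 2]/(2 * 3) expnM leq_exp2r.
have h7 : 2 * k <= j * (s + 29) by move: ju h5; lia.
have h8 : (2 * k) ^ 2 <= s * (s + 29) ^ 2.
  apply: (@leq_trans ((j * (s + 29)) ^ 2)); first by rewrite leq_exp2r.
  by rewrite expnMn leq_mul2r j2 orbT.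
have : (2 * s) ^ 2 < (s + 29) ^ 2.
  rewrite -(@ltn_pmul2l s); last lia.
  by apply: leq_trans h8; rewrite !expnMn; move: h6; rewrite (expnS s 2); lia.
by rewrite ltn_exp2r //; lia.
Qed.

(** For [k > 50] and [N < 4096] a prime at most [N - 3], hence off the hole, lies in the window. For
    larger [N] with [N ^ 3 >= k ^ 4] the crude bound [N ^ a < k ^ k] fails: [a >= 3 k / 4] if
    [k > 256], and otherwise [a >= 2 k / 3] with [k ^ 3 <= 2 ^ 24 <= N ^ 2]. *)
Lemma not_smooth_window (k N : nat) : odd k -> 7 <= k -> k.*2 < N -> ~ smooth_window k N.
Proof.
move=> ok hk kN; have [h|h] := ltnP k 50; first by apply: not_smooth_window_medium; rewrite ?hk.
have k51 : 50 < k by move: h; rewrite leq_eqVlt => /orP[/eqP e|//]; rewrite -e in ok.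
have [hN|hN] := ltnP N 4096.
  move=> H; have hN3 : 53 <= N - 3 < 4096.
    by apply/andP; split; [lia | apply: leq_ltn_trans (leq_subr _ _) hN].
  have [q pq hq] := prime_gap hN3.
  by have := H q q pq _ _ (dvdnn q); lia.
have [h3|h3] := ltnP (N ^ 3) (k ^ 4); first exact: not_smooth_window_large.
move=> H; have kN' : k <= N by lia.
have k0 : 0 < k by lia.
have N2 : 2 < N by lia.
pose a := k - (primepi k.+2).+1.
have [hk2|hk2] := ltnP 256 k.
  have hp : 4 * (primepi k.+2).+1 <= k by have := @primepi_lt k.+2; lia.
  have : N ^ a < k ^ k by apply: smooth_window_expn_lt => //; rewrite /a; lia.
  rewrite ltnNge => /negP; apply.
  rewrite -(@leq_exp2r _ _ 3) // -!expnM [a * 3]mulnC (expnM N).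
  apply: leq_trans (_ : (k ^ 4) ^ a <= _); last by rewrite leq_exp2r //; rewrite /a; lia.
  by rewrite -!expnM leq_exp2l // /a; lia.
have hp : 3 * (primepi k.+2).+1 <= k.
  have := primepi_le k.+2; have [k57|k57] := leqP 57 k; first lia.
  have : k \in [:: 51; 53; 55] by rewrite !inE; lia.
  by rewrite !inE => /or3P[] /eqP-> _; vm_compute.
have : N ^ a < k ^ k by apply: smooth_window_expn_lt => //; rewrite /a; lia.
rewrite ltnNge => /negP; apply.
rewrite -(@leq_exp2r _ _ 2) // -!expnM [a * 2]mulnC (expnM N).
apply: (@leq_trans ((k ^ 3) ^ a)); first by rewrite -!expnM leq_exp2l // /a; lia.
rewrite leq_exp2r; last by rewrite /a; lia.
apply: (@leq_trans ((2 ^ 8) ^ 3)); first by rewrite leq_exp2r.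
by rewrite -expnM -[8 * 3]/(12 * 2) expnM leq_exp2r.
Qed.

(** * Smooth numbers in short windows *)

Definition smooth (b x : nat) : Prop := forall p, prime p -> p %| x -> p <= b.

Lemma prime_powP (p x : nat) : 0 < x -> (forall r, prime r -> r %| x -> r = p) ->
  exists k, x = p ^ k.
Proof.
move=> x0 H; have [|k ->] := @p_natP p x; last by exists k.
by apply/pnatP => // r pr rx; rewrite inE /= (H r pr rx).
Qed.

Lemma smooth_dvd (b d x : nat) : d %| x -> smooth b x -> smooth b d.
Proof. by move=> dx H p pp pd; apply: H => //; apply: dvdn_trans dx. Qed.

Lemma smooth3_odd (x : nat) : odd x -> smooth 3 x -> exists k, x = 3 ^ k.
Proof.
move=> ox H; apply: prime_powP => [|r pr rx]; first by case: x ox {H}.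
have := H r pr rx; have := prime_gt1 pr; have := dvdn_odd rx ox; lia.
Qed.

Lemma smooth3_ndvd3 (x : nat) : 0 < x -> ~~ (3 %| x) -> smooth 3 x -> exists k, x = 2 ^ k.
Proof.
move=> x0 n3 H; apply: prime_powP => // r pr rx.
have : r != 3 by apply: contraNneq n3 => <-.
have := H r pr rx; have := prime_gt1 pr; lia.
Qed.

Lemma smooth_step (b b' x : nat) : smooth b' x ->
  (forall p, prime p -> b < p <= b' -> ~~ (p %| x)) -> smooth b x.
Proof.
move=> H H' p pp px; rewrite leqNgt; apply/negP => bp.
by have pb := H p pp px; have := H' p pp; rewrite bp pb px => /(_ isT).
Qed.

Lemma smooth35 (x : nat) : smooth 5 x -> ~~ (5 %| x) -> smooth 3 x.
Proof.
move=> H n5; apply: (smooth_step H) => p pp hp.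
have : p \in [:: 4; 5] by rewrite !inE; lia.
by rewrite !inE => /orP[] /eqP e; subst p.
Qed.

Lemma smooth37 (x : nat) : smooth 7 x -> ~~ (5 %| x) -> ~~ (7 %| x) -> smooth 3 x.
Proof.
move=> H n5 n7; apply: (smooth_step H) => p pp hp.
have : p \in [:: 4; 5; 6; 7] by rewrite !inE; lia.
by rewrite !inE => /or4P[] /eqP e; subst p.
Qed.

(** The order of 3 modulo [80 = 16 * 5] is 4; the single modulus serves the arguments modulo 8, 16
    and 5 below. *)
Lemma pow3_mod80 (a : nat) : 3 ^ a %% 80 \in [:: 1; 3; 9; 27].
Proof.
elim: a => // a; rewrite expnS -modnMmr !inE => /or4P[] /eqP ->; by [].
Qed.

Lemma pow3_succ (a b : nat) : 3 ^ a + 1 = 2 ^ b -> a <= 1.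
Proof.
move=> e; rewrite leqNgt; apply/negP => a2.
have h9 : 9 <= 3 ^ a by rewrite -[9]/(3 ^ 2) leq_exp2l.
have b3 : 2 < b by rewrite -(@ltn_exp2l 2) // -e; apply: leq_ltn_trans (_ : 4 <= 9) _ => //; lia.
have : 8 %| 3 ^ a + 1 by rewrite e -[8]/(2 ^ 3) dvdn_exp2l.
have := pow3_mod80 a; rewrite !inE; lia.
Qed.

Lemma pow2_succ (a b : nat) : 2 ^ b + 1 = 3 ^ a -> a <= 2.
Proof.
move=> e; rewrite leqNgt; apply/negP => a2.
have h27 : 27 <= 3 ^ a by rewrite -[27]/(3 ^ 3) leq_exp2l.
have b4 : 3 < b.
  rewrite ltnNge; apply/negP => b3; have : 2 ^ b <= 2 ^ 3 by rewrite leq_exp2l.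
  by rewrite -[2 ^ 3]/8; lia.
have h16 : 16 %| 2 ^ b by rewrite -[16]/(2 ^ 4) dvdn_exp2l.
(* Being 1 modulo 16, the power [3 ^ a] must be 1 modulo 80. *)
have : 5 %| 2 ^ b by have := pow3_mod80 a; rewrite -e !inE; lia.
by rewrite Euclid_dvdX //; case/andP.
Qed.

Lemma pow3_gt1 (x k : nat) : x = 3 ^ k -> 1 < x -> 3 %| x.
Proof. by case: k => [->|k ->] //; rewrite expnS dvdn_mulr. Qed.

(** The odd one is a power of 3, so the other is prime to 3 and a power of 2. *)
Lemma smooth3_consecutive (x : nat) : 3 < x -> smooth 3 x -> smooth 3 x.+1 -> x = 8.
Proof.
move=> x3 h1 h2; case ox : (odd x).
  have [a ea] := smooth3_odd ox h1.
  have d3 : 3 %| x by apply: (pow3_gt1 ea); lia.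
  have [b eb] : exists b, x.+1 = 2 ^ b by apply: smooth3_ndvd3 => //; lia.
  have := @pow3_succ a b; rewrite -ea addn1 => /(_ eb) a1.
  have : x <= 3 ^ 1 by rewrite ea leq_exp2l.
  by rewrite expn1; lia.
have ox1 : odd x.+1 by rewrite /= ox.
have [a ea] := smooth3_odd ox1 h2.
have d3 : 3 %| x.+1 by apply: (pow3_gt1 ea); lia.
have [b eb] : exists b, x = 2 ^ b by apply: smooth3_ndvd3 => //; lia.
have := @pow2_succ a b; rewrite -ea -eb addn1 => /(_ erefl) a2.
have : a \in [:: 0; 1; 2] by rewrite !inE; lia.
by rewrite !inE => /or3P[] /eqP e; move: ea x3; rewrite e ?expn0 ?expn1 -?[3 ^ 2]/9; lia.
Qed.

Lemma smooth3_odd_add2 (x : nat) : odd x -> 1 < x -> smooth 3 x -> smooth 3 x.+2 -> False.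
Proof.
move=> ox x1 h1 h2; have ox2 : odd x.+2 by rewrite /= negbK.
have [a ea] := smooth3_odd ox h1; have [b eb] := smooth3_odd ox2 h2.
have := pow3_gt1 ea x1; have := pow3_gt1 eb isT; lia.
Qed.

(** If [n] is 1 modulo 4, halving gives two odd 3-smooth numbers at distance 2. Otherwise dividing
    by 4 gives consecutive ones, [w = 1, 2, 3] or [8]. *)
Lemma smooth3_add4 (n : nat) : odd n -> 5 < n -> smooth 3 n.+1 -> smooth 3 (n - 3) ->
  n \in [:: 7; 11; 15; 35].
Proof.
move=> on n5 h1 h2; case n4 : (n %% 4 == 1).
  case: (@smooth3_odd_add2 (n - 3)./2); [lia | lia | |].
    by apply: smooth_dvd h2; apply/dvdnP; exists 2; lia.
  by apply: smooth_dvd h1; apply/dvdnP; exists 2; lia.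
pose w := (n - 3) %/ 4.
have s1 : smooth 3 w by apply: smooth_dvd h2; apply/dvdnP; exists 4; rewrite /w; lia.
have s2 : smooth 3 w.+1 by apply: smooth_dvd h1; apply/dvdnP; exists 4; rewrite /w; lia.
have [w3|w3] := leqP w 3; first by rewrite !inE; move: w3; rewrite /w; lia.
by have := smooth3_consecutive w3 s1 s2; rewrite /w !inE; lia.
Qed.

(** Either 5 divides neither [n + 1] nor [n - 3], or it divides neither [n] nor [n - 2], and the
    corresponding pair is 3-smooth. *)
Lemma no_smooth5 (n : nat) : odd n -> 6 < n ->
  smooth 5 n.+1 -> smooth 5 n -> smooth 5 (n - 2) -> smooth 5 (n - 3) -> False.
Proof.
move=> on n6 hA hB hC hD.
case n5 : ((5 %| n) || (5 %| n - 2)).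
  have : n \in [:: 7; 11; 15; 35].
    by apply: smooth3_add4; [| lia | apply: smooth35 hA _; lia | apply: smooth35 hD _; lia].
  rewrite !inE => /or4P[] /eqP e; subst n.
  - by have := hB 7 isT isT.
  - by have := hB 11 isT isT.
  - by have := hC 13 isT isT.
  - by have := hB 7 isT isT.
apply: (@smooth3_odd_add2 (n - 2)); [lia | lia | apply: smooth35 hC _; lia |].
have -> : (n - 2).+2 = n by lia.
by apply: smooth35 hB _; lia.
Qed.

(** The differences of the four numbers are at most 4, so 5 and 7 each divide at most one of them
    and two are 3-smooth. Only the pair [n], [n - 3] leads to 27. *)
Lemma smooth7_eq27 (n : nat) : odd n -> 10 < n ->
  smooth 7 n.+1 -> smooth 7 n -> smooth 7 (n - 2) -> smooth 7 (n - 3) -> n = 27.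
Proof.
move=> on n10 hA hB hC hD.
have n11 : n != 11 by apply/eqP => e; subst n; have := hB 11 isT isT.
pose g x := ~~ (5 %| x) && ~~ (7 %| x).
have gs x : smooth 7 x -> g x -> smooth 3 x by move=> h /andP[]; apply: smooth37.
have : [|| g n.+1 && g n, g n && g (n - 2), g (n - 2) && g (n - 3)
     | [|| g n.+1 && g (n - 3), g n.+1 && g (n - 2) | g n && g (n - 3)]].
  by rewrite /g; lia.
case/or4P => [/andP[/(gs _ hA) sA /(gs _ hB) sB]|/andP[/(gs _ hB) sB /(gs _ hC) sC]
             |/andP[/(gs _ hC) sC /(gs _ hD) sD]|].
- have := smooth3_consecutive _ sB sA; lia.
- case: (@smooth3_odd_add2 (n - 2)); [lia | lia | by [] |].
  by have -> : (n - 2).+2 = n by lia.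
- have := @smooth3_consecutive (n - 3) _ sD _; have -> : (n - 3).+1 = n - 2 by lia.
  move=> h; have := h _ sC; lia.
case/or3P => [/andP[/(gs _ hA) sA /(gs _ hD) sD]|/andP[/(gs _ hA) sA /(gs _ hC) sC]
             |/andP[/(gs _ hB) sB /(gs _ hD) sD]].
- have := smooth3_add4 on _ sA sD; rewrite !inE => /(_ ltac:(lia)) /or4P[] /eqP e; subst n => //.
    by have := hC 13 isT isT.
  by have := hC 11 isT isT.
- have oC : odd (n - 2) by lia.
  have [c ec] := smooth3_odd oC sC.
  case: c ec => [|c]; first by rewrite expn0; lia.
  rewrite expnS => ec.
  have sy : smooth 3 (3 ^ c + 1) by apply: smooth_dvd sA; apply/dvdnP; exists 3; lia.
  have nd : ~~ (3 %| 3 ^ c + 1).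
    by case: c ec {sy} => [|c]; [rewrite expn0; lia | rewrite expnS; lia].
  have y0 : 0 < 3 ^ c + 1 by rewrite addn1.
  have [x ex] := smooth3_ndvd3 y0 nd sy.
  have := pow3_succ ex; case: c ec {sy nd ex y0} => [|[|c]] //; rewrite ?expn0 ?expn1; lia.
have [b eb] := smooth3_odd on sB.
case: b eb => [|b]; first by rewrite expn0; lia.
rewrite expnS => eb.
have sy : smooth 3 (3 ^ b - 1) by apply: smooth_dvd sD; apply/dvdnP; exists 3; lia.
have nd : ~~ (3 %| 3 ^ b - 1).
  by case: b eb {sy} => [|b]; [rewrite expn0; lia | rewrite expnS; lia].
have y0 : 0 < 3 ^ b - 1 by lia.
have [x ex] := smooth3_ndvd3 y0 nd sy.
have : 2 ^ x + 1 = 3 ^ b by lia.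
move=> /pow2_succ; case: b eb {sy nd ex y0} => [|[|[|b]]] //; rewrite ?expn0 ?expn1 -?[3 ^ 2]/9; lia.
Qed.

Import Order.TTheory GRing.Theory Num.Theory.
Local Open Scope ring_scope.

(** * The remainder polynomial of the partition (n, 2) *)

(** The double factorial [(2 j - 1)!!]. *)
Definition dfact (j : nat) : nat := \prod_(i < j) (i.*2.+1)%N.

Lemma dfactS (j : nat) : dfact j.+1 = (dfact j * j.*2.+1)%N.
Proof. by rewrite /dfact big_ord_recr. Qed.

Lemma dfact_gt0 (j : nat) : (0 < dfact j)%N.
Proof. by rewrite prodn_gt0. Qed.

Lemma HeAuxE (k : nat) : HeAux k = (He k, He k.+1).
Proof.
elim: k => [|k IH] //; rewrite [RHS](surjective_pairing (He k.+1, He k.+2)) /=.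
by rewrite /He /=; case: (HeAux k).
Qed.

Lemma HeSS (k : nat) : He k.+2 = He k.+1 * 'X - He k *+ k.+1.
Proof. by rewrite {1}/He /= HeAuxE. Qed.

Lemma coef_He (n k : nat) : (He n)`_k =
  if odd (n + k) then 0 else (-1) ^+ (n - k)./2 * ('C(n, k) * dfact (n - k)./2)%:R.
Proof.
have [N] := ubnP n; elim: N n k => // N IH [|[|n]] k nN.
- rewrite /He /= coef1; case: k => [|k] /=; first by rewrite /dfact big_ord0.
  by rewrite bin0n /= mul0n mulr0 if_same.
- rewrite /He /= coefX; case: k => [|[|k]] //=; first by rewrite /dfact big_ord0.
  by rewrite bin_small // mul0n mulr0 if_same.
rewrite HeSS coefB coefMX coefMn !IH; [|lia|lia].
case: k => [|k] /=.
  rewrite !addn0 !subn0 /= sub0r negbK; case: ifP => on; first by rewrite mul0rn oppr0.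
  rewrite !bin0 !mul1n dfactS exprS -[_ *+ n.+1]mulr_natr -!mulrA -natrM.
  have -> : n./2.*2 = n by lia.
  by rewrite mulN1r.
rewrite !addnS /= !negbK.
case: ifP => on; first by rewrite mul0rn subr0.
have [kn|kn] := leqP k n; last first.
  rewrite (@bin_small n); last lia.
  rewrite mul0n mulr0 mul0rn subr0; have [->|kn1] := eqVneq k n.+1.
    by rewrite !binn !subnn.
  by rewrite !bin_small //; lia.
have [e|kn'] := eqVneq k n; first by move: on; rewrite e addnn odd_double.
rewrite !subSS; have [m em] : exists m, (n - k)%N = m.*2.+1 by exists (n - k)./2; lia.
have -> : (n - k.+1)./2 = m by lia.
have -> : (n.+1 - k)./2 = m.+1 by lia.
rewrite exprS dfactS -[_ *+ n.+1]mulr_natr mulN1r !mulNr -opprD -!mulrA -mulrDr -!natrM -natrD.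
congr (- (_ * _%:R)).
have h : (n.+1 * 'C(n, k.+1) = m.*2.+1 * 'C(n.+1, k.+1))%N.
  by rewrite (mul_bin_down n.+1 k.+1) subSS em.
rewrite binS; nia.
Qed.

Lemma deriv_He (n : nat) : (He n.+1)^`() = He n *+ n.+1.
Proof.
apply/polyP=> k; rewrite coef_deriv coefMn !coef_He addnS subSS /= negbK.
case: ifP => _; first by rewrite !mul0rn.
rewrite -!mulrnAr; congr (_ * _).
rewrite -!mulrnA; congr (1 *+ _).
by rewrite mulnAC [RHS]mulnAC; congr (_ * _)%N; rewrite mulnC -mul_bin_diag mulnC.
Qed.

Definition HeW2 (n : nat) : {poly int} := ('X^2 + 1) * He n + He (n - 2) *+ n.*2.

(** Uses [He' (n + 1) = (n + 1) He n] and the recurrence twice. The factor [n.-1] is the Vandermonde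
    factor of the degree sequence [2, n + 1]. *)
Lemma Wr_He (n : nat) : (2 <= n)%N -> Wr [:: He 2; He n.+1] = HeW2 n *+ n.-1.
Proof.
move=> hn; case: n hn => [|[|n]] // _.
rewrite /Wr /= (expand_det_row _ ord0) !big_ord_recl big_ord0 /cofactor !det_mx11 !mxE /=.
rewrite addr0 !(expr0, expr1, mul1r, mulN1r, mulrN) /=.
have -> : He 2 = 'X ^+ 2 - 1 by rewrite /He /= mulr1n.
rewrite (deriv_He n.+2) /HeW2 !subSS subn0 (HeSS n.+1) (HeSS n).
have -> : ('X ^+ 2 - 1 : {poly int})^`() = 'X *+ 2 by rewrite derivB derivXn derivC subr0.
move: (He n) (He n.+1) => b a.
have -> : n.+2.*2 = (2 * n.+2)%N by lia.
ring.
Qed.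

Lemma Delta2 (a b : nat) : Delta [:: a; b] = b%:Z - a%:Z.
Proof.
rewrite /Delta /= !big_ord_recl !big_ord0 /= big_mkcond !big_ord_recl big_ord0 /=.
by rewrite [X in _ * (X * _)]big_mkcond !big_ord_recl big_ord0 /= mul1r !mulr1.
Qed.

Lemma degseq2 (n : nat) : degseq [:: n; 2%N] = [:: 2%N; n.+1].
Proof. by rewrite /degseq /= addn1. Qed.

Lemma hook2_step0 (b : nat) :
  hook2_step [:: 0; b]%N = [:: 0; if (2 < b)%N then b - 2 else b]%N.
Proof.
have rb : removable2 [:: 0; b]%N b = (2 < b)%N.
  by rewrite /removable2 !inE; case: b => [|[|[|b]]] //=; lia.
rewrite /hook2_step /= rb /= orbF; case: (ltnP 2 b) => // hb /=.
by rewrite eqxx; case: eqP => // e; rewrite -e in hb.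
Qed.

Lemma iter_hook2_step (m b : nat) : (0 < b <= m.*2.+2)%N ->
  iter m hook2_step [:: 0; b]%N = [:: 0; if odd b then 1 else 2]%N.
Proof.
elim: m b => [|m IH] b hb; first by case: b hb => [|[|[|b]]].
rewrite iterSr hook2_step0; case: ltnP => h2.
  by rewrite IH; [have -> : odd (b - 2) = odd b by lia | lia].
by rewrite IH //; lia.
Qed.

(** The entry 2 drops to 0 at once; then [n + 1] descends by steps of 2 and stops at 1 for [n] even,
    at 2 for [n] odd. *)
Lemma core2_size2 (n : nat) : (2 <= n)%N -> core2_size [:: n; 2%N] = odd n.
Proof.
move=> hn; rewrite /core2_size degseq2 /core2_degseq.
have -> : sumn [:: 2; n.+1]%N = n.+3 by rewrite /=; lia.
rewrite iterSr; have -> : hook2_step [:: 2; n.+1]%N = [:: 0; n.+1]%N.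
  by case: n hn => [|[|n]].
rewrite iter_hook2_step; last lia.
by rewrite /=; case: (odd n).
Qed.

Lemma HeW_two (n : nat) : (2 <= n)%N -> HeW [:: n; 2%N] = HeW2 n.
Proof.
move=> hn; rewrite /HeW degseq2 Delta2.
have -> : n.+1%:Z - 2%:Z = n.-1%:Z by lia.
rewrite [map He _]/= Wr_He //; apply/polyP=> k.
rewrite coef_map_id0 ?div0z // coefMn -[_ *+ n.-1]mulr_natr natz mulzK //.
by case: n hn => [|[|n]].
Qed.

Lemma Rem_two (n : nat) : (2 <= n)%N -> Rem [:: n; 2%N] = drop_poly (odd n) (HeW2 n).
Proof. by move=> hn; rewrite /Rem core2_size2 // HeW_two. Qed.

Definition hcoef (n j : nat) : int := (-1) ^+ j * ('C(n, j.*2) * dfact j)%:R.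

(** The coefficient of [x^(n + 2 - 2 j)] in [HeW2 n]. Counting from the top makes it depend, modulo
    [p] and for fixed [j], only on the class of [n] (with 1 itself excluded). *)
Definition wcoef (n j : nat) : int :=
  hcoef n j + (if j is j'.+1 then hcoef n j' else 0)
  + (if j is j'.+2 then hcoef (n - 2) j' *+ n.*2 else 0).

Definition Qpol (n : nat) : {poly int} := \poly_(i < n./2.+2) wcoef n (n./2.+1 - i).

Lemma hcoef_eq0 (n j : nat) : (n < j.*2)%N -> hcoef n j = 0.
Proof. by move=> h; rewrite /hcoef bin_small // mul0n mulr0. Qed.

Lemma coef_He_hcoef (n j : nat) : (j.*2 <= n)%N -> (He n)`_(n - j.*2) = hcoef n j.
Proof.
move=> h; rewrite coef_He; have -> : odd (n + (n - j.*2)) = false by lia.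
have -> : (n - (n - j.*2))%N = j.*2 by lia.
by rewrite doubleK bin_sub.
Qed.

Lemma coef_He_gt (n k : nat) : (n < k)%N -> (He n)`_k = 0.
Proof. by move=> h; rewrite coef_He bin_small // mul0n mulr0 if_same. Qed.

Lemma coef_He_odd (n k : nat) : odd (n + k) -> (He n)`_k = 0.
Proof. by move=> h; rewrite coef_He h. Qed.

Lemma coef_HeW2 (n k : nat) : (HeW2 n)`_k =
  (if (k < 2)%N then 0 else (He n)`_(k - 2)) + (He n)`_k + (He (n - 2))`_k *+ n.*2.
Proof. by rewrite /HeW2 coefD coefMn mulrDl mul1r coefD coefXnM. Qed.

Lemma coef_HeW2_wcoef (n k j : nat) : (2 <= n)%N -> (k + j.*2 = n.+2)%N ->
  (HeW2 n)`_k = wcoef n j.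
Proof.
move=> hn hk; rewrite coef_HeW2 /wcoef; congr (_ + _ + _).
- case: ltnP => h; first by rewrite hcoef_eq0 //; lia.
  by rewrite -coef_He_hcoef; [congr _`_ _; lia | lia].
- case: j hk => [|j] hk; first by rewrite coef_He_gt //; lia.
  by rewrite -coef_He_hcoef; [congr _`_ _; lia | lia].
case: j hk => [|[|j]] hk; try by rewrite coef_He_gt ?mul0rn //; lia.
by rewrite -coef_He_hcoef; [congr (_`_ _ *+ _); lia | lia].
Qed.

Lemma drop_HeW2 (n : nat) : (2 <= n)%N -> drop_poly (odd n) (HeW2 n) = Qpol n \Po 'X^2.
Proof.
move=> hn; apply/polyP=> i; rewrite coef_drop_poly coef_comp_poly_Xn // coef_poly.
case: ifP => [/dvdnP[t ->]|h]; last first.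
  have o : odd i by rewrite dvdn2 in h; rewrite -[odd i]negbK h.
  rewrite coef_HeW2 (@coef_He_odd n (i + odd n)); last lia.
  rewrite (@coef_He_odd (n - 2)) ?mul0rn; last lia.
  case: ifP => h2; first by rewrite !addr0.
  by rewrite coef_He_odd ?addr0 //; lia.
rewrite mulnK //; case: ltnP => ht.
  by apply: coef_HeW2_wcoef => //; lia.
rewrite coef_HeW2 !coef_He_gt ?mul0rn; try lia.
by rewrite if_same !addr0.
Qed.

Lemma wcoef0 (n : nat) : wcoef n 0 = 1.
Proof. by rewrite /wcoef /hcoef /= bin0 /dfact big_ord0 !addr0 mulr1. Qed.

(** At [n = 1] it fails: there the truncated [n - 2] is 0 and [wcoef 1 2 = 2]. This is the source of
    the exclusion of 1 below. *)
Lemma wcoef_eq0 (n j : nat) : n != 1 -> (n./2.+1 < j)%N -> wcoef n j = 0.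
Proof.
move=> n1; case: j => [|[|j]] //= hj; rewrite /wcoef.
rewrite (@hcoef_eq0 n j.+2) ?(@hcoef_eq0 n j.+1) ?add0r; try lia.
case: n n1 hj => [|n] n1 hj; first by rewrite double0 mulr0n.
by rewrite hcoef_eq0 ?mul0rn //; lia.
Qed.

Lemma coef_Qpol (n i : nat) : (i <= n./2.+1)%N -> (Qpol n)`_i = wcoef n (n./2.+1 - i).
Proof. by move=> h; rewrite coef_poly ltnS h. Qed.

Lemma size_Qpol (n : nat) : size (Qpol n) = n./2.+2.
Proof. by apply: size_poly_eq; rewrite subnn wcoef0. Qed.

Lemma monic_Qpol (n : nat) : Qpol n \is monic.
Proof. by rewrite monicE lead_coefE size_Qpol /= coef_Qpol // subnn wcoef0. Qed.

(** * The constant term and its divisibility relation to the other coefficients *)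

Lemma fact_double (m : nat) : (m.*2`! = 2 ^ m * m`! * dfact m)%N.
Proof.
elim: m => [|m IH]; first by rewrite /dfact big_ord0.
rewrite doubleS !factS IH dfactS expnS -[m.*2.+2]/(m.+1.*2) -mul2n; lia.
Qed.

Lemma fact_doubleS (m : nat) : (m.*2.+1`! = 2 ^ m * m`! * dfact m.+1)%N.
Proof. rewrite factS fact_double dfactS; lia. Qed.

(** Follows from [(2 m)! = 2^m m! (2 m - 1)!!]. It shows that a short double factorial times a
    Hermite coefficient is a multiple of the full [dfact m]. *)
Lemma bin_dfact_even (m j : nat) : (j <= m)%N ->
  ('C(m.*2, j.*2) * dfact j * dfact (m - j) = 'C(m, j) * dfact m)%N.
Proof.
move=> jm; have h2 : (0 < 2 ^ m)%N by rewrite expn_gt0.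
have e2 : (2 ^ m = 2 ^ j * 2 ^ (m - j))%N by rewrite -expnD subnKC.
apply/eqP; rewrite -(@eqn_pmul2r (2 ^ m * (j`! * (m - j)`!))) ?muln_gt0 ?h2 ?fact_gt0 //.
have e : (m.*2`! = 'C(m.*2, j.*2) * (j.*2`! * (m - j).*2`!))%N.
  by rewrite doubleB bin_fact // leq_double.
apply/eqP; transitivity (m.*2`!).
  by rewrite e !fact_double e2; ring.
by rewrite fact_double -(bin_fact jm); ring.
Qed.

Lemma bin_dfact_odd (m j : nat) : (j <= m)%N ->
  ('C(m.*2.+1, j.*2) * dfact j * dfact (m - j).+1 = 'C(m, j) * dfact m.+1)%N.
Proof.
move=> jm; have h2 : (0 < 2 ^ m)%N by rewrite expn_gt0.
have e2 : (2 ^ m = 2 ^ j * 2 ^ (m - j))%N by rewrite -expnD subnKC.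
apply/eqP; rewrite -(@eqn_pmul2r (2 ^ m * (j`! * (m - j)`!))) ?muln_gt0 ?h2 ?fact_gt0 //.
have e : (m.*2.+1`! = 'C(m.*2.+1, j.*2) * (j.*2`! * (m - j).*2.+1`!))%N.
  have -> : (m - j).*2.+1 = (m.*2.+1 - j.*2)%N by lia.
  by rewrite bin_fact //; lia.
apply/eqP; transitivity (m.*2.+1`!).
  by rewrite e fact_double fact_doubleS e2; ring.
by rewrite fact_doubleS -(bin_fact jm); ring.
Qed.

Lemma hcoef_odd (m j : nat) : (j <= m)%N ->
  hcoef m.*2.+1 j * (dfact (m - j).+1)%:R = (-1) ^+ j * 'C(m, j)%:R * (dfact m.+1)%:R.
Proof. by move=> jm; rewrite /hcoef -!mulrA -!natrM bin_dfact_odd. Qed.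

Lemma hcoef_even (m j : nat) : (j <= m)%N ->
  hcoef m.*2 j * (dfact (m - j))%:R = (-1) ^+ j * 'C(m, j)%:R * (dfact m)%:R.
Proof. by move=> jm; rewrite /hcoef -!mulrA -!natrM bin_dfact_even. Qed.

Lemma dfact0 : dfact 0 = 1%N. Proof. by rewrite /dfact big_ord0. Qed.

Lemma dfact1 : dfact 1 = 1%N. Proof. by rewrite dfactS dfact0. Qed.

Lemma Qpol0_odd (m : nat) : (0 < m)%N ->
  (Qpol m.*2.+1)`_0 = (-1) ^+ m.+1 * (dfact m.+1)%:R.
Proof.
case: m => // m _; have h1 := hcoef_odd (leqnn m.+1); have h2 := hcoef_odd (leqnn m).
rewrite subnn binn dfact1 !mulr1 in h1; rewrite subnn binn dfact1 !mulr1 in h2.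
rewrite coef_Qpol // /= uphalf_double subn0 /wcoef.
rewrite (@hcoef_eq0 _ m.+2) ?add0r; last lia.
have -> : (m.+1.*2.+1 - 2)%N = m.*2.+1 by lia.
rewrite h1 h2 -mulrnAr -mulrnA.
have -> : (dfact m.+1 * m.+1.*2.+1.*2 = 2 * dfact m.+2)%N by rewrite [in RHS]dfactS; lia.
by rewrite natrM !exprS; ring.
Qed.

Lemma Qpol0_even (m : nat) : (0 < m)%N ->
  (Qpol m.*2)`_0 = (-1) ^+ m.+1 * (m.*2.+1 * dfact m.-1)%:R.
Proof.
case: m => // m _; have h1 := hcoef_even (leqnn m.+1); have h2 := hcoef_even (leqnn m).
rewrite subnn binn dfact0 !mulr1 in h1; rewrite subnn binn dfact0 !mulr1 in h2.
rewrite coef_Qpol // doubleK subn0 /wcoef.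
rewrite (@hcoef_eq0 _ m.+2) ?add0r; last lia.
have -> : (m.+1.*2 - 2)%N = m.*2 by lia.
rewrite h1 h2 dfactS /= -mulrnAr -mulrnA !natrM !exprS doubleS.
have -> : m.*2.+2.*2 = (4 * m + 4)%N by lia.
have -> : m.*2.+3 = (2 * m + 3)%N by lia.
have -> : m.*2.+1 = (2 * m + 1)%N by lia.
by ring.
Qed.

Lemma dvd_Qpol_odd (m i : nat) : (0 < m)%N -> (i <= m.+1)%N ->
  ((dfact m.+1)%:R %| (Qpol m.*2.+1)`_i * (dfact i.+1)%:R)%Z.
Proof.
move=> m0 im; rewrite coef_Qpol /= uphalf_double // /wcoef !mulrDl.
set D := (dfact m.+1)%:R.
have key j : (j <= m)%N -> (m - j <= i)%N -> (D %| hcoef m.*2.+1 j * (dfact i.+1)%:R)%Z.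
  move=> jm ji; have [x ->] : exists x, dfact i.+1 = (dfact (m - j).+1 * x)%N.
    elim: i {im} ji => [|i IH]; first by rewrite leqn0 => /eqP->; exists 1%N; rewrite muln1.
    rewrite leq_eqVlt => /orP[/eqP->|]; first by exists 1%N; rewrite muln1.
    by rewrite ltnS => /IH[x e]; exists (x * i.+1.*2.+1)%N; rewrite dfactS e mulnA.
  by rewrite natrM mulrA hcoef_odd // mulrAC dvdz_mull.
apply: rpredD; first apply: rpredD.
- have [->|i0] := posnP i.
    by rewrite subn0 hcoef_eq0 ?mul0r ?dvdz0 //; lia.
  by apply: key; lia.
- case e : (m.+1 - i)%N => [|j]; first by rewrite mul0r dvdz0.
  by apply: key; lia.
case e : (m.+1 - i)%N => [|[|j]]; rewrite ?mul0r ?dvdz0 //.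
have ej : i = (m.-1 - j)%N by lia.
have -> : (m.*2.+1 - 2)%N = m.-1.*2.+1 by lia.
rewrite mulrnAl {1}ej hcoef_odd; last lia.
rewrite prednK // /D dfactS -[_ *+ _]mulr_natr -!mulrA dvdz_mull // dvdz_mull // -natrM.
by apply/dvdzP; exists 2; rewrite -natrM; congr _%:R; lia.
Qed.

(** For [i] neither 0 nor the degree, each of the three terms of [wcoef] is a multiple of the double
    factorial after multiplication by [dfact i], but the factor [n + 1] only appears in their
    sum. *)
Lemma dvd_Qpol_even (m i : nat) : (0 < m)%N -> (i <= m.+1)%N ->
  ((m.*2.+1 * dfact m.-1)%:R %| (Qpol m.*2)`_i * (dfact i)%:R)%Z.
Proof.
case: m => // m _ im; rewrite [_.-1]/=.
have [->|i0] := posnP i.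
  by rewrite Qpol0_even // dfact0 mulr1 dvdz_mull.
have [->|im'] := eqVneq i m.+2.
  rewrite coef_Qpol doubleK // subnn wcoef0 mul1r !dfactS doubleS natrM.
  apply/dvdzP; exists (m.*2.+1)%:R; rewrite -!natrM; congr _%:R; lia.
rewrite coef_Qpol doubleK // /wcoef.
case e : (m.+2 - i)%N => [|j]; first by lia.
have j1 : (j.+1 <= m.+1)%N by lia.
have ei : i = (m.+1 - j)%N by lia.
have h1 := hcoef_even j1; have h2 := @hcoef_even m.+1 j (ltnW j1).
rewrite subSS in h1; rewrite -ei in h2.
have ei' : i = (m - j).+1 by lia.
have h1' : hcoef m.+1.*2 j.+1 * (dfact i)%:R =
   (-1) ^+ j.+1 * 'C(m.+1, j.+1)%:R * (dfact m.+1)%:R * (i.*2.-1)%:R.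
  have -> : i.*2.-1 = (m - j).*2.+1 by lia.
  by rewrite ei' dfactS natrM mulrA h1.
have h3 : (if j is j'.+1 then hcoef (m.+1.*2 - 2) j' *+ m.+1.*2.*2 else 0) * (dfact i)%:R
   = (-1) ^+ j.+1 * (m.+1 * (if j is j'.+1 then 'C(m, j') else 0))%:R * (dfact m)%:R *+ 4.
  case: j e j1 ei {h1 h2 ei' h1'} => [|j] e j1 ei; first by rewrite muln0 mulr0 mul0r mul0rn mul0r.
  have -> : (m.+1.*2 - 2)%N = m.*2 by lia.
  rewrite mulrnAl; have -> : i = (m - j)%N by lia.
  rewrite hcoef_even; last lia.
  have -> : m.+1.*2.*2 = (m.+1 * 4)%N by lia.
  by rewrite natrM mulrnA !exprS -[_ *+ m.+1]mulr_natr; ring.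
rewrite !mulrDl h1' h2; rewrite h3.
have hj : (m.+1 * (if j is j'.+1 then 'C(m, j') else 0) = j * 'C(m.+1, j))%N.
  by case: (j) => [|j']; rewrite ?muln0 // (mul_bin_diag m.+1 j').
have hr : (j.+1 * 'C(m.+1, j.+1) = i * 'C(m.+1, j))%N by rewrite mul_bin_left ei.
have [i' [ei1 em]] : exists i', i = i'.+1 /\ m = (i' + j)%N by exists (m - j)%N; lia.
rewrite hj dfactS; move: ('C(_, j)) ('C(_, _)) hr => a b hr {hj h3 h1' h1 h2}.
have hr' : (j%:R + 1) * b%:R = (i'%:R + 1) * a%:R :> int.
  by rewrite -[1]/(1%:R) -!natrD -!natrM; congr _%:R; lia.
(* The quotient is exact only modulo the relation [(j + 1) b = (i' + 1) a] between neighbouring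
   binomials. *)
apply/dvdzP; exists ((-1) ^+ j.+1 * (a%:R + b%:R + 2 * (i'%:R - 1) * b%:R)).
have -> : i.*2.-1 = (2 * i' + 1)%N by lia.
have -> : m.+1.*2.+1 = (2 * i' + 2 * j + 3)%N by lia.
have -> : m.*2.+1 = (2 * i' + 2 * j + 1)%N by lia.
apply/eqP; rewrite -subr_eq0 exprS; apply/eqP; move: (_ ^+ j) (dfact m) => s d.
transitivity (- 4 * s * d%:R * ((j%:R + 1) * b%:R - (i'%:R + 1) * a%:R)); first by ring.
by rewrite hr' subrr mulr0.
Qed.

Lemma absz_Qpol0_odd (n : nat) : (2 <= n)%N -> odd n -> absz (Qpol n)`_0 = dfact n./2.+1.
Proof.
move=> hn on; have -> : n = n./2.*2.+1 by lia.
by rewrite Qpol0_odd ?abszMsign ?natz /= ?uphalf_double //; lia.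
Qed.

Lemma absz_Qpol0_even (n : nat) : (2 <= n)%N -> ~~ odd n ->
  absz (Qpol n)`_0 = (n.+1 * dfact n./2.-1)%N.
Proof.
move=> hn on; have -> : n = n./2.*2 by lia.
by rewrite Qpol0_even ?abszMsign ?natz /= ?doubleK //; lia.
Qed.

Lemma Qpol0_neq0 (n : nat) : (2 <= n)%N -> (Qpol n)`_0 != 0.
Proof.
move=> hn; rewrite -absz_eq0 -lt0n; case on: (odd n).
  by rewrite absz_Qpol0_odd // dfact_gt0.
by rewrite absz_Qpol0_even ?on // muln_gt0 dfact_gt0.
Qed.

Lemma dvdn_Qpol_odd (n i : nat) : (2 <= n)%N -> odd n -> (i <= n./2.+1)%N ->
  (absz ((Qpol n)`_0)%R %| absz ((Qpol n)`_i)%R * dfact i.+1)%N.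
Proof.
move=> hn on im; rewrite absz_Qpol0_odd //.
have m0 : (0 < n./2)%N by lia.
have := dvd_Qpol_odd m0 im; have <- : n = n./2.*2.+1 by lia.
by rewrite dvdzE abszM !natz !absz_nat.
Qed.

Lemma dvdn_Qpol_even (n i : nat) : (2 <= n)%N -> ~~ odd n -> (i <= n./2.+1)%N ->
  (absz ((Qpol n)`_0)%R %| absz ((Qpol n)`_i)%R * dfact i)%N.
Proof.
move=> hn on im; rewrite absz_Qpol0_even //.
have m0 : (0 < n./2)%N by lia.
have := dvd_Qpol_even m0 im; have <- : n = n./2.*2 by lia.
by rewrite dvdzE abszM !natz !absz_nat.
Qed.

(** * Reduction modulo a prime *)

Lemma natr_ffact (R : pzRingType) (n k : nat) :
  (n ^_ k)%:R = \prod_(i < k) (n%:R - i%:R) :> R.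
Proof.
elim: k => [|k IH]; first by rewrite big_ord0.
rewrite big_ord_recr /= -IH ffactnSr natrM; have [kn|kn] := leqP k n.
  by rewrite natrB.
by rewrite ffact_small // !mul0r.
Qed.

Lemma dvdn_dfact (p j : nat) : odd p -> (p < j.*2)%N -> (p %| dfact j)%N.
Proof.
move=> op; elim: j => // j IH; rewrite dfactS => h.
have [e|ne] := eqVneq p j.*2.+1; first by rewrite e dvdn_mull.
by apply: dvdn_mulr; apply: IH; lia.
Qed.

Lemma prime_dvd_fact (p k : nat) : prime p -> (p %| k`!)%N -> (p <= k)%N.
Proof.
move=> pp; elim: k => [|k IH]; first by rewrite dvdn1 => /eqP e; rewrite e in pp.
by rewrite factS Euclid_dvdM // => /orP[/dvdn_leq|/IH] h; [apply: h | apply: ltnW].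
Qed.

Section ModP.

Variables (F : fieldType) (p : nat).
Hypotheses (chF : p \in [pchar F]) (op : odd p).

(** If [p < 2 j], both sides vanish with [dfact j]. Otherwise [(2 j)!] is invertible and the
    binomials can be compared through falling factorials, which are polynomial in [n]. *)
Lemma hcoef_congr (n n0 j : nat) : n%:R = n0%:R :> F ->
  (hcoef n j)%:~R = (hcoef n0 j)%:~R :> F.
Proof.
move=> e; rewrite /hcoef !rmorphM !rmorph_nat.
have pp := pcharf_prime chF.
have [h|h] := ltnP p j.*2.
  by have := dvdn_dfact op h; rewrite (dvdn_pcharf chF) => /eqP ->; rewrite !mulr0.
have f0 : (j.*2`!)%:R != 0 :> F.
  rewrite -(dvdn_pcharf chF); apply/negP => /(prime_dvd_fact pp).
  by move: op h; lia.
congr (_ * (_ * _)); apply: (mulIf f0).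
rewrite -!natrM !bin_ffact !natr_ffact; apply: eq_bigr => i _; by rewrite e.
Qed.

Lemma wcoef_congr (n n0 j : nat) : (2 <= n)%N -> n0 != 1%N -> n%:R = n0%:R :> F ->
  (wcoef n j)%:~R = (wcoef n0 j)%:~R :> F.
Proof.
move=> hn n01 e; rewrite /wcoef !rmorphD /=; congr (_ + _ + _).
- exact: hcoef_congr.
- by case: j => // j; apply: hcoef_congr.
case: j => [|[|j]] //; rewrite !rmorphMn /=.
have e2 : n.*2%:R = n0.*2%:R :> F by rewrite -!muln2 !natrM e.
rewrite -[_ *+ n.*2]mulr_natr -[_ *+ n0.*2]mulr_natr e2; case: n0 n01 e e2 => [|[|n0]] // _ e e2; first by rewrite !mulr0.
congr (_ * _); apply: hcoef_congr.
by rewrite natrB // e natrB.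
Qed.

Definition redp (q : {poly int}) : {poly F} := map_poly intr q.

Lemma redpM (a b : {poly int}) : redp (a * b) = redp a * redp b.
Proof. exact: rmorphM. Qed.

Lemma coef_redp (a : {poly int}) (i : nat) : (redp a)`_i = (a`_i)%:~R.
Proof. by rewrite coef_map. Qed.

Lemma redp_Qpol (n n0 : nat) : (2 <= n)%N -> n0 != 1%N -> (n0 <= n)%N ->
  n%:R = n0%:R :> F -> redp (Qpol n) = 'X^(n./2 - n0./2) * redp (Qpol n0).
Proof.
move=> hn n01 n0n e; apply/polyP=> i; rewrite coefXnM !coef_redp !coef_poly.
have hh : (n0./2 <= n./2)%N by apply: half_leq.
case: (ltnP i (n./2 - n0./2)) => h1.
  have -> : (i < n./2.+2)%N by lia.
  by rewrite (wcoef_congr _ hn n01 e) wcoef_eq0 //; lia.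
case: (ltnP i n./2.+2) => h2; last by rewrite ltnNge (_ : (n0./2.+2 <= i - (n./2 - n0./2))%N) //; lia.
rewrite (_ : (i - (n./2 - n0./2) < n0./2.+2)%N); last lia.
by rewrite (wcoef_congr _ hn n01 e); congr ((wcoef _ _)%:~R); lia.
Qed.

Lemma size_redp_monic (q : {poly int}) : q \is monic -> size (redp q) = size q.
Proof.
move=> mq; rewrite size_map_poly_id0 // (monicP mq) rmorph1; exact: oner_neq0.
Qed.

Lemma monic_redp (q : {poly int}) : q \is monic -> redp q \is monic.
Proof. exact: monic_map. Qed.

Lemma redp_dvd (n a : nat) (q h G : {poly int}) :
  redp (q * h) = 'X^a * redp G -> (q`_0)%:~R != 0 :> F -> redp q %| redp G.
Proof.
rewrite redpM => e q0; rewrite -(@Gauss_dvdpr _ _ ('X^a)); last first.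
  rewrite coprimep_expr // -['X]subr0 -polyC0 coprimep_XsubC.
  by rewrite /root horner_coef0 coef_redp.
by rewrite -e dvdp_mulr.
Qed.

End ModP.

(** * Newton polygons *)

Definition valz (p : nat) (x : int) : nat := logn p (absz x).

Lemma valzM (p : nat) (x y : int) : x != 0 -> y != 0 -> valz p (x * y) = (valz p x + valz p y)%N.
Proof. by move=> x0 y0; rewrite /valz abszM lognM // absz_gt0. Qed.

Lemma dvdz_valz (p k : nat) (x : int) : prime p -> x != 0 ->
  ((p ^ k)%:Z %| x)%Z = (k <= valz p x)%N.
Proof. by move=> pp x0; rewrite dvdzE absz_nat pfactor_dvdn // absz_gt0. Qed.

Definition gauss_weight (p A B : nat) (f : {poly int}) (i : nat) : nat :=
  (B * valz p f`_i + A * i)%N.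

Lemma gauss_min (p A B : nat) (f : {poly int}) : f != 0 ->
  exists i, [/\ f`_i != 0,
    forall k, f`_k != 0 -> (gauss_weight p A B f i <= gauss_weight p A B f k)%N &
    forall k, f`_k != 0 -> (i < k)%N -> (gauss_weight p A B f i < gauss_weight p A B f k)%N].
Proof.
move=> f0; set w := gauss_weight p A B f; set N := size f.
have N0 : (0 < N)%N by rewrite size_poly_gt0.
have lN : ((size f).-1 < N)%N by rewrite prednK.
pose P := [pred i : 'I_N | f`_i != 0].
have P0 : P (Ordinal lN) by rewrite /= -lead_coefE lead_coef_eq0.
(* One natural number encodes a lexicographic order: least weight first, then largest index. *)
case: (@arg_minnP _ (Ordinal lN) P (fun i => w i * N.+1 + (N - i))%N P0) => i fi hmin.
have key k : f`_k != 0 -> (w i * N.+1 + (N - i) <= w k * N.+1 + (N - k))%N.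
  move=> fk; have kN : (k < N)%N.
    by rewrite ltnNge; apply: contraNN fk => h; rewrite nth_default.
  exact: (hmin (Ordinal kN)).
have iN := ltn_ord i.
exists (i : nat); split => // k fk.
  have := key k fk; case: (leqP (w i) (w k)) => // h; nia.
move=> ik; have := key k fk; case: (ltnP (w i) (w k)) => // h.
have kN : (k < N)%N by rewrite ltnNge; apply: contraNN fk => h'; rewrite nth_default.
nia.
Qed.

(* The Gauss norm [min_i (B v(f_i) + A i)] is additive on products; the coefficient of
   [q * h] indexed by the sum of the last minimising indices is not cancelled. *)
Lemma gauss_factor (p A B D : nat) (q h : {poly int}) :
  prime p -> q \is monic -> (q * h)`_0 != 0 ->
  (forall i, (q * h)`_i != 0 ->
     (B * valz p (q * h)`_0%R <= B * valz p (q * h)`_i%R + A * i + D)%N) ->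
  (B * valz p q`_0%R <= A * (size q).-1 + D)%N.
Proof.
move=> pp mq; rewrite coef0M mulf_eq0 negb_or => /andP[q0 h0] H.
have qn0 : q != 0 by rewrite monic_neq0.
have hn0 : h != 0 by apply: contraNneq h0 => ->; rewrite coef0.
have [i [qi imin ilast]] := gauss_min p A B qn0.
have [j [hj jmin jlast]] := gauss_min p A B hn0.
set V := (valz p q`_i%R + valz p h`_j%R)%N.
have main : ~~ ((p ^ V.+1)%:Z %| q`_i * h`_j)%Z.
  by rewrite dvdz_valz ?mulf_neq0 // valzM // ltnn.
have hsum : (q * h)`_(i + j) != 0 /\ (valz p (q * h)`_(i + j)%R <= V)%N.
  have ndiv : ~~ ((p ^ V.+1)%:Z %| (q * h)`_(i + j))%Z.
    rewrite coefM; have li : (i < (i + j).+1)%N by lia.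
    rewrite (bigD1 (Ordinal li)) //= addKn; set S := \sum_(_ < _ | _) _.
    have dS : ((p ^ V.+1)%:Z %| S)%Z.
      rewrite /S; apply: rpred_sum => k; rewrite -val_eqE /= => ki.
      have [->|qk] := eqVneq q`_k 0; first by rewrite mul0r dvdz0.
      have [->|hk] := eqVneq h`_(i + j - k) 0; first by rewrite mulr0 dvdz0.
      have kl := ltn_ord k.
      rewrite dvdz_valz ?mulf_neq0 // valzM //.
      have := imin k qk; have := jmin _ hk; rewrite /gauss_weight /V.
      have eA : (A * (i + j - k) + A * k = A * j + A * i)%N.
        by rewrite -!mulnDr; congr (_ * _)%N; lia.
      rewrite [(_ < _)%N]ltnNge => h1 h2; apply/negP => /(leq_mul (leqnn B)); rewrite !mulnDr.
      move: ki; rewrite neq_ltn => /orP[ki|ki].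
        have jl : (j < i + j - k)%N by lia.
        have := jlast _ hk jl; rewrite /gauss_weight; move: h1 h2 eA.
        move: (A * (i + j - k))%N (A * k)%N (A * j)%N (A * i)%N => a1 a2 a3 a4.
        move: (B * valz p (h`_(i + j - k)%N)%R)%N (B * valz p q`_k%R)%N => b1 b2.
        by move: (B * valz p h`_j%R)%N (B * valz p q`_i%R)%N => b3 b4; lia.
      have := ilast _ qk ki; rewrite /gauss_weight; move: h1 h2 eA.
      move: (A * (i + j - k))%N (A * k)%N (A * j)%N (A * i)%N => a1 a2 a3 a4.
      move: (B * valz p (h`_(i + j - k)%N)%R)%N (B * valz p q`_k%R)%N => b1 b2.
      by move: (B * valz p h`_j%R)%N (B * valz p q`_i%R)%N => b3 b4; lia.
    by apply: contraNN main; rewrite (rpredDr _ dS).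
  have nz : (q * h)`_(i + j) != 0 by apply: contraNneq ndiv => ->; rewrite dvdz0.
  by split => //; rewrite leqNgt -dvdz_valz.
(* The minimum for [q] is at most its value [A * deg q] at the leading term, the minimum for [h] at
   most its value at the constant term; then [B * valz p h_0] cancels. *)
have [nz hV] := hsum; have := H _ nz; rewrite valzM //.
have ql : q`_(size q).-1 != 0 by rewrite -lead_coefE (monicP mq).
have := imin _ ql; have := jmin _ h0; rewrite /gauss_weight.
rewrite -lead_coefE (monicP mq) [valz p 1]/valz absz1 logn1 !muln0 addn0 add0n !mulnDr.
have := leq_mul (leqnn B) hV; rewrite /V mulnDr.
move: (A * i)%N (A * j)%N (A * (size q).-1)%N => a1 a2 a3.
move: (B * valz p (q * h)`_(i + j)%N)%N (B * valz p q`_i%R)%N (B * valz p h`_j%R)%N => b1 b2 b3.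
move: (B * valz p q`_0%R)%N (B * valz p h`_0%R)%N => b4 b5; lia.
Qed.

(** * Valuations of double factorials *)

Lemma dfact_odd (j : nat) : odd (dfact j).
Proof. by elim: j => [|j IH]; rewrite ?dfact0 // dfactS oddM IH /= odd_double. Qed.

Lemma prime_dvd_dfact (p i : nat) : prime p -> (p %| dfact i)%N -> (p < i.*2)%N.
Proof.
move=> pp; elim: i => [|i IH]; first by rewrite dfact0 dvdn1 => /eqP e; rewrite e in pp.
rewrite dfactS Euclid_dvdM // => /orP[/IH|/dvdn_leq h]; first by lia.
by have := h isT; lia.
Qed.

(* Among 1, 3, ..., 2 j - 1 the multiples of p are p times 1, 3, ..., 2 g - 1. *)
Lemma logn_dfact (p j : nat) : prime p -> odd p ->
  logn p (dfact j) = ((j + p./2) %/ p + logn p (dfact ((j + p./2) %/ p)))%N.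
Proof.
move=> pp op; have p0 := prime_gt0 pp.
elim: j => [|j IH].
  by rewrite add0n divn_small ?dfact0 ?logn1 //; move: op; lia.
rewrite {1}dfactS lognM ?dfact_gt0 // IH addSn divnS //.
case: (boolP (p %| (j + p./2).+1)%N) => hd; last first.
  rewrite !add0n (_ : logn p j.*2.+1 = 0)%N ?addn0 //.
  apply/eqP; rewrite -leqn0 leqNgt logn_gt0 mem_primes pp /=.
  apply: contraNN hd => hd; rewrite -(@Gauss_dvdr p 2); last by rewrite coprimen2.
  have -> : (2 * (j + p./2).+1 = j.*2.+1 + p)%N by move: op; lia.
  by rewrite dvdn_addl.
have [t et] := dvdnP hd.
have e1 : ((j + p./2) %/ p = t.-1)%N.
  have t0 : (0 < t)%N by case: t et.
  have -> : (j + p./2 = t.-1 * p + p.-1)%N by case: t t0 et => // t _; rewrite mulSn /=; lia.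
  by rewrite divnMDl // divn_small ?addn0 // prednK.
have t0 : (0 < t)%N by case: t et {e1}.
rewrite e1 add1n prednK //.
have -> : (j.*2.+1 = p * t.-1.*2.+1)%N by case: t et {e1} t0 => // t; move: op; lia.
have lp : logn p p = 1%N by rewrite -{2}[p]expn1 pfactorK.
rewrite lognM // lp -[t in RHS]prednK // dfactS lognM ?dfact_gt0 //; lia.
Qed.

Lemma logn_dfact_le (p j : nat) : prime p -> odd p ->
  (p.-1 * logn p (dfact j.+1) <= j.*2)%N.
Proof.
move=> pp op; have [k] := ubnP j; elim: k j => // k IH j; rewrite ltnS => jk.
rewrite logn_dfact //; set g := (_ %/ p)%N.
have hg : (g * p <= j.+1 + p./2)%N by apply: leq_divM.
have p3 : (2 < p)%N by rewrite odd_prime_gt2.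
case eg : g => [|g']; first by rewrite dfact0 logn1 muln0.
have [q ep] : exists q, p = q.*2.+1 by exists p./2; lia.
have q0 : (0 < q)%N by lia.
have gj : (g' < j)%N by move: hg; rewrite eg ep /= uphalf_double; nia.
have := IH g' _; rewrite mulnDr; move: (logn p _) => y /(_ ltac:(lia)) hy.
apply: leq_trans (leq_add (leqnn _) hy) _; move: hg; rewrite eg ep /= uphalf_double; nia.
Qed.

(** Sharper than the case [p = 3] of the general bound, so that 9 cannot divide [q(0)] when
    [deg q = 2], nor 27 when [deg q = 3]. *)
Lemma logn3_dfact_le (j : nat) : (4 * logn 3 (dfact j.+1) <= 3 * j + 1)%N.
Proof.
have [k] := ubnP j; elim: k j => // k IH j; rewrite ltnS => jk.
rewrite logn_dfact //; set g := (_ %/ 3)%N.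
have hg : (g * 3 <= j.+1 + 3./2)%N by apply: leq_divM.
case eg : g => [|g']; first by rewrite dfact0 logn1 muln0.
have gj : (g' < j)%N by move: hg; rewrite eg /=; lia.
have := IH g' _; move: (logn 3 _) => y /(_ ltac:(lia)) hy.
by move: hg; rewrite eg /=; lia.
Qed.

Lemma valz_le (p : nat) (x y : int) (d : nat) : x != 0 -> y != 0 -> (0 < d)%N ->
  (absz x %| absz y * d)%N -> (valz p x <= valz p y + logn p d)%N.
Proof.
move=> x0 y0 d0 h; rewrite /valz -lognM ?absz_gt0 //.
by apply: dvdn_leq_log h; rewrite muln_gt0 absz_gt0 y0.
Qed.

Section Factor.

Variables (n : nat) (q h : {poly int}).
Hypotheses (hn : (2 <= n)%N) (mq : q \is monic) (qh : q * h = Qpol n).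

Local Notation l := (size q).-1.
Local Notation c := q`_0.

Lemma factor_c_neq0 : c != 0.
Proof. by have := Qpol0_neq0 hn; rewrite -qh coef0M mulf_eq0 negb_or => /andP[]. Qed.

Lemma coef_Qpol_bound (i : nat) : (Qpol n)`_i != 0 -> (i <= n./2.+1)%N.
Proof.
by apply: contraNT; rewrite -ltnNge => hi; rewrite nth_default // size_Qpol.
Qed.

Lemma valz_Qpol0_le (p i : nat) : (Qpol n)`_i != 0 ->
  (valz p (Qpol n)`_0%R <= valz p (Qpol n)`_i%R + logn p (dfact i.+1))%N.
Proof.
move=> qi; have hi := coef_Qpol_bound qi; have q0 := Qpol0_neq0 hn.
apply: valz_le; rewrite ?dfact_gt0 //; case on : (odd n); first exact: dvdn_Qpol_odd.
apply: dvdn_trans (dvdn_Qpol_even hn (negbT on) hi) _.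
by rewrite dfactS mulnA dvdn_mulr.
Qed.

Lemma factor_gauss (p A B D : nat) : prime p ->
  (forall i, (i <= n./2.+1)%N -> (B * logn p (dfact i.+1) <= A * i + D)%N) ->
  (B * valz p c <= A * l + D)%N.
Proof.
move=> pp H; apply: (@gauss_factor p A B D q h) => //; rewrite ?qh ?Qpol0_neq0 //.
move=> i qi; apply: leq_trans (leq_mul (leqnn B) (valz_Qpol0_le p qi)) _.
by rewrite mulnDr -addnA leq_add2l H ?coef_Qpol_bound.
Qed.

Lemma factor_valz_le (p : nat) : prime p -> odd p -> (p.-1 * valz p c <= l.*2)%N.
Proof.
move=> pp op; have -> : l.*2 = (2 * l + 0)%N by lia.
by apply: factor_gauss => // i _; rewrite addn0 mul2n logn_dfact_le.
Qed.

Lemma factor_valz3_le : (4 * valz 3 c <= 3 * l + 1)%N.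
Proof. by apply: factor_gauss => // i _; apply: logn3_dfact_le. Qed.

Lemma factor_valz_even (p A B : nat) : prime p -> ~~ odd n ->
  (forall i, (0 < i <= n./2.+1)%N -> (B * logn p (dfact i) <= A * i)%N) ->
  (B * valz p c <= A * l)%N.
Proof.
move=> pp on H; rewrite -[leqRHS]addn0.
apply: (@gauss_factor p A B 0 q h) => //; rewrite ?qh ?Qpol0_neq0 //.
move=> i qi; have hi := coef_Qpol_bound qi; rewrite addn0.
have [->|i0] := posnP i; first by rewrite muln0 addn0.
have hv : (valz p (Qpol n)`_0%R <= valz p (Qpol n)`_i%R + logn p (dfact i))%N.
  by apply: valz_le; rewrite ?dfact_gt0 ?Qpol0_neq0 //; apply: dvdn_Qpol_even.
apply: leq_trans (leq_mul (leqnn B) hv) _.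
by rewrite mulnDr leq_add2l H // i0.
Qed.

Lemma absz_dvd_Qpol0 : (absz c %| absz ((Qpol n)`_0)%R)%N.
Proof. by rewrite -qh coef0M abszM dvdn_mulr. Qed.

Lemma factor_c_odd : odd (absz c).
Proof.
apply: (dvdn_odd absz_dvd_Qpol0); case on : (odd n).
  by rewrite absz_Qpol0_odd // dfact_odd.
by rewrite absz_Qpol0_even ?on // oddM /= on dfact_odd.
Qed.

Lemma dvd_factor_c_le (p : nat) : prime p -> (p %| absz c)%N -> odd p /\ (p <= l.*2.+1)%N.
Proof.
move=> pp pc; have op : odd p by apply: (dvdn_odd pc factor_c_odd).
split => //; have := factor_valz_le pp op.
have : (0 < valz p c)%N by rewrite /valz logn_gt0 mem_primes pp pc absz_gt0 factor_c_neq0.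
have := prime_gt1 pp; nia.
Qed.

(** For even [n] the prime [2 l + 1] is excluded as well, since [dfact i] replaces [dfact i.+1] in
    the divisibility relation. *)
Lemma dvd_factor_c_lt (p : nat) : ~~ odd n -> prime p -> (p %| absz c)%N -> (p < l.*2.+1)%N.
Proof.
move=> on pp pc; rewrite ltnNge; apply/negP => lp.
have op : odd p by apply: (dvdn_odd pc factor_c_odd).
have v0 : (0 < valz p c)%N by rewrite /valz logn_gt0 mem_primes pp pc absz_gt0 factor_c_neq0.
(* For [i] at most [M = n./2.+1] one has [(i - 1) / i <= (M - 1) / M], which makes the slope
   strictly less than [1 / l]. *)
have : (n./2.+1 * l * valz p c <= n./2 * l)%N.
  apply: factor_valz_even => // i /andP[i0 iM].
  have := @logn_dfact_le p i.-1 pp op; rewrite prednK //; move: (logn p _) => v hv.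
  have hlv : (l * v <= i.-1)%N by nia.
  apply: (@leq_trans (n./2.+1 * i.-1)); first by rewrite -mulnA leq_mul2l hlv orbT.
  nia.
have [l0|l0] := posnP l; last first.
  by move=> hh; have := leq_trans (leq_pmulr _ v0) hh; rewrite leq_pmul2r // ltnn.
have c1 : c = 1 by rewrite -(monicP mq) lead_coefE l0.
by move: pc pp; rewrite c1 absz1 dvdn1 => /eqP ->.
Qed.

Lemma factor_redp (p n0 : nat) : prime p -> odd p -> ~~ (p %| absz c)%N ->
  n0 != 1%N -> (n0 <= n)%N -> (p %| n - n0)%N -> redp 'F_p q %| redp 'F_p (Qpol n0).
Proof.
move=> pp op pc n01 n0n pd; have chF := pchar_Fp pp.
have e : n%:R = n0%:R :> 'F_p.
  by apply/eqP; rewrite -subr_eq0 -natrB // -(dvdn_pcharf chF).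
apply: (@redp_dvd _ n (n./2 - n0./2) q h).
  by rewrite qh; apply: (redp_Qpol chF op).
by rewrite -(dvdz_pcharf chF) dvdzE.
Qed.

(** Here [n] is [p - 1] modulo [p]. The constant term of [Qpol p.-1] contains the factor [p], and
    [dfact i] is prime to [p] for [2 i < p], so every non-leading coefficient vanishes modulo
    [p]. *)
Lemma factor_ndvd_succ (p : nat) : prime p -> odd p -> ~~ (p %| absz c)%N -> (0 < l)%N ->
  ~~ (p %| n.+1)%N.
Proof.
move=> pp op pc l0; apply/negP => pd; have chF := pchar_Fp pp.
have p3 : (2 < p)%N by rewrite odd_prime_gt2.
have pn : (p <= n.+1)%N by apply: dvdn_leq.
have e : n%:R = p.-1%:R :> 'F_p.
  apply/eqP; rewrite -subr_eq0 -natrB; last lia.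
  rewrite -(dvdn_pcharf chF); have -> : (n - p.-1 = n.+1 - p)%N by lia.
  by rewrite dvdn_subr // dvdnn.
have red : redp 'F_p (Qpol p.-1) = 'X^(p.-1./2.+1).
  apply/polyP => i; rewrite coef_redp coefXn.
  case: (ltngtP i p.-1./2.+1) => hi.
  - have := @dvdn_Qpol_even p.-1 i ltac:(lia) ltac:(lia) ltac:(lia).
    rewrite absz_Qpol0_even; [|lia|lia]; rewrite prednK ?prime_gt0 // => /(dvdn_trans (dvdn_mulr _ (dvdnn p))).
    rewrite Euclid_dvdM // => /orP[|/(prime_dvd_dfact pp)]; last by lia.
    by move=> hp; apply/eqP; rewrite -(dvdz_pcharf chF) dvdzE.
  - by rewrite nth_default ?size_Qpol.
  by rewrite hi coef_Qpol // subnn wcoef0.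
have : redp 'F_p q %| redp 'F_p 1.
  apply: (@redp_dvd _ n (n./2 - p.-1./2 + p.-1./2.+1) q h).
    rewrite qh (redp_Qpol chF op hn _ _ e) ?red -?exprD; [|lia|lia].
    by rewrite /redp rmorph1 mulr1.
  by rewrite -(dvdz_pcharf chF) dvdzE.
rewrite /redp rmorph1 dvdp1 size_redp_monic // => /eqP e1.
by move: l0; rewrite e1.
Qed.

End Factor.

(** * Excluding proper factors *)

Lemma Qpol_small :
  [/\ (Qpol 0)`_0 = 1, (Qpol 2)`_0 = 3 /\ (Qpol 2)`_1 = 0, (Qpol 3)`_0 = 3,
      [/\ (Qpol 4)`_0 = -5, (Qpol 4)`_1 = 5 & (Qpol 4)`_2 = -5] & (Qpol 5)`_0 = -15].
Proof.
have d2 : dfact 2 = 3 by rewrite !dfactS dfact0.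
have d3 : dfact 3 = 15 by rewrite !dfactS dfact0.
by do ?split; rewrite coef_Qpol // /wcoef /hcoef /= ?d3 ?d2 ?dfact1 ?dfact0.
Qed.

Lemma monic_size2_root (R : idomainType) (a g G : {poly R}) : a * g = G ->
  a \is monic -> size a = 2 -> G \is monic -> size G = 3 ->
  a`_0 ^+ 2 - G`_1 * a`_0 + G`_0 = 0.
Proof.
move=> e ma sa mG sG.
have a1 : a`_1 = 1 by rewrite -(monicP ma) lead_coefE sa.
have ea : a = 'X - (- a`_0)%:P.
  apply/polyP => i; rewrite polyCN opprK coefD coefX coefC.
  case: i => [|[|i]] /=; rewrite ?add0r ?addr0 //.
  by rewrite nth_default // sa.
have : G.[- a`_0] = 0.
  by rewrite -e hornerM {1}ea hornerXsubC subrr mul0r.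
have G2 : G`_2 = 1 by rewrite -(monicP mG) lead_coefE sG.
rewrite horner_coef sG !big_ord_recl big_ord0 /= /bump /= G2 => e0.
by rewrite -[RHS]e0 expr0 expr1 !addr0; ring.
Qed.

Lemma monic_size3_cofactor (R : idomainType) (a g G : {poly R}) : a * g = G ->
  a \is monic -> size a = 3 -> G \is monic -> size G = 4 ->
  exists b, [/\ G`_0 = a`_0 * b, G`_1 = a`_0 + a`_1 * b & G`_2 = a`_1 + b].
Proof.
move=> e ma sa mG sG.
have mg : g \is monic by rewrite -(monicMl _ ma) e.
have sg : size g = 2.
  have := sG; rewrite -e size_monicM ?monic_neq0 // sa; lia.
have g1 : g`_1 = 1 by rewrite -(monicP mg) lead_coefE sg.
have g2 : g`_2 = 0 by rewrite nth_default ?sg.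
have a2 : a`_2 = 1 by rewrite -(monicP ma) lead_coefE sa.
exists g`_0; rewrite -e !coefM !big_ord_recl !big_ord0 /= /bump /= g1 g2 a2.
by rewrite !addr0 mulr0 add0r mulr1 mul1r mulr1.
Qed.

Section NoFactor.

Variables (n l : nat) (q h : {poly int}).
Hypotheses (hn : (2 <= n)%N) (mq : q \is monic) (qh : q * h = Qpol n) (sq : size q = l.+1).

Local Notation c := q`_0.

Lemma prime_dvd_c (p : nat) : prime p -> (p %| absz c)%N ->
  [/\ odd p, (p <= l.*2.+1)%N & ~~ odd n -> (p < l.*2.+1)%N].
Proof.
move=> pp pc; have [op] := dvd_factor_c_le hn mq qh pp pc; rewrite sq => ple.
by split=> // on; have := dvd_factor_c_lt hn mq qh on pp pc; rewrite sq.
Qed.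

Lemma factor_size_le (p n0 : nat) : prime p -> odd p -> ~~ (p %| absz c)%N ->
  n0 != 1%N -> (n0 <= n)%N -> (p %| n - n0)%N -> (l <= n0./2.+1)%N.
Proof.
move=> pp op pc n01 n0n pd; have := factor_redp hn qh pp op pc n01 n0n pd.
move=> /dvdp_leq; rewrite monic_neq0 ?monic_redp ?monic_Qpol // => /(_ isT).
by rewrite !size_redp_monic ?monic_Qpol // size_Qpol sq.
Qed.

Lemma factor_eq_const (p n0 : nat) : prime p -> odd p -> ~~ (p %| absz c)%N ->
  n0 != 1%N -> (n0 <= n)%N -> (p %| n - n0)%N -> l = n0./2.+1 ->
  (p %| absz (c - (Qpol n0)`_0)%R)%N.
Proof.
move=> pp op pc n01 n0n pd el; have := factor_redp hn qh pp op pc n01 n0n pd.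
have ms : size (redp 'F_p q) = size (redp 'F_p (Qpol n0)).
  by rewrite !size_redp_monic ?monic_Qpol // size_Qpol sq el.
move=> dv; have : redp 'F_p q %= redp 'F_p (Qpol n0) by rewrite -dvdp_size_eqp // ms.
rewrite eqp_monic ?monic_redp ?monic_Qpol // => /eqP e.
have : (redp 'F_p q)`_0 = (redp 'F_p (Qpol n0))`_0 by rewrite e.
rewrite !coef_redp => e0.
have := dvdz_pcharf (pchar_Fp pp) (c - (Qpol n0)`_0); rewrite rmorphB /= e0 subrr eqxx.
by rewrite dvdzE.
Qed.

Lemma factor_large_prime (p i : nat) : (0 < l)%N -> prime p -> odd p -> ~~ (p %| absz c)%N ->
  (i <= n.+1)%N -> i != n.-1 -> (n + 2 < i + l.*2)%N -> ~~ (p %| i)%N.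
Proof.
move=> l0 pp op pc i1 i2 i3; apply/negP => pi.
have [e|e] := eqVneq i n.+1.
  by have := factor_ndvd_succ hn mq qh pp op pc; rewrite sq -e pi => /(_ l0).
have n0 : (n - (n - i) = i)%N by clear -i1 e; lia.
have n1 : (n - i != 1)%N by clear -i1 i2 e hn; lia.
have := @factor_size_le p (n - i) pp op pc n1 (leq_subr _ _); rewrite n0 pi => /(_ isT).
by clear -i1 i2 i3 l0 hn e; lia.
Qed.

Lemma no_factor_ge4 : (4 <= l)%N -> (l.*2 <= n./2.+1)%N -> False.
Proof.
move=> l4 ln; have l0 : (0 < l)%N by lia.
apply: (@not_smooth_window l.*2.-1 n.+1); [lia | lia | lia |].
move=> p i pp hi iN pi; rewrite leqNgt; apply/negP => hp.
have op : odd p by apply: contraTT pi => /(prime_oddPn pp) e; move: hp; rewrite e; lia.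
have pc : ~~ (p %| absz c)%N by apply/negP => pc; have [_ h1 _] := prime_dvd_c pp pc; clear -h1 hp; lia.
have : ~~ (p %| i)%N by apply: factor_large_prime pc _ _ _ => //; clear -hi iN l4 ln hn; lia.
by rewrite pi.
Qed.

(** For odd [n] the bound [b] must reach [2 l + 1]; for even [n] it may stop at [2 l - 1], as
    [2 l + 1] cannot divide [q(0)]. *)
Lemma factor_smooth (b i : nat) : (0 < l)%N -> (l.*2 < b.+2)%N -> (odd n -> l.*2 < b)%N ->
  (1 < b)%N -> (i <= n.+1)%N -> i != n.-1 -> (n + 2 < i + l.*2)%N -> smooth b i.
Proof.
move=> l0 hb hbo b1 i1 i2 i3 p pp pi; rewrite leqNgt; apply/negP => bp.
have op : odd p by apply: contraTT pi => /(prime_oddPn pp) e; move: bp; rewrite e; lia.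
suff pc : ~~ (p %| absz c)%N by have := factor_large_prime l0 pp op pc i1 i2 i3; rewrite pi.
apply/negP => pc; have [_ h1 h2] := prime_dvd_c pp pc.
by case on : (odd n); [have := hbo on | have := h2 (negbT on)]; clear -h1 hb op bp; lia.
Qed.

Lemma no_factor_even1 : ~~ odd n -> l = 1%N -> False.
Proof.
move=> on l1; pose p := pdiv n.+1; have pp : prime p by apply: pdiv_prime; clear -hn; lia.
have pd : (p %| n.+1)%N by apply: pdiv_dvd.
have op : odd p by apply: dvdn_odd pd _; rewrite /= on.
have pc : ~~ (p %| absz c)%N.
  by apply/negP => pc; have [_ _ /(_ on)] := prime_dvd_c pp pc; have := odd_prime_gt2 op pp; lia.
have : ~~ (p %| n.+1)%N by apply: factor_large_prime pc _ _ _ => //; lia.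
by rewrite pd.
Qed.

(** Either 5 misses [n] and [n - 2], whose halves are consecutive and 3-smooth, so [n = 18] and 19
    intervenes; or [n + 1] and [n - 3] are powers of 3. *)
Lemma no_factor_even3 : ~~ odd n -> l = 3 -> (l.*2 <= n./2.+1)%N -> False.
Proof.
move=> on l3 ln.
have sA : smooth 5 n.+1 by apply: factor_smooth; lia.
have sB : smooth 5 n by apply: factor_smooth; lia.
have sC : smooth 5 (n - 2) by apply: factor_smooth; lia.
have sD : smooth 5 (n - 3) by apply: factor_smooth; lia.
case n5 : ((5 %| n.+1) || (5 %| n - 3))%N.
  have sm : smooth 3 n./2.
    by apply: (@smooth_dvd _ _ n); [apply/dvdnP; exists 2%N; lia | apply: smooth35 sB _; lia].
  have sm1 : smooth 3 n./2.-1.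
    by apply: (@smooth_dvd _ _ (n - 2)); [apply/dvdnP; exists 2%N; lia | apply: smooth35 sC _; lia].
  have := @smooth3_consecutive n./2.-1 ltac:(lia) sm1; rewrite prednK; last lia.
  move=> /(_ sm) e; have en : n = 18 by lia.
  by have := sA 19; rewrite en => /(_ isT isT).
have [a ea] : exists k, n.+1 = (3 ^ k)%N by apply: smooth3_odd; [lia | apply: smooth35 sA _; lia].
have [b eb] : exists k, (n - 3)%N = (3 ^ k)%N by apply: smooth3_odd; [lia | apply: smooth35 sD _; lia].
by have := pow3_gt1 ea ltac:(lia); have := pow3_gt1 eb ltac:(lia); lia.
Qed.

Lemma even2_eq8 : ~~ odd n -> l = 2 -> (l.*2 <= n./2.+1)%N -> n = 8.
Proof.
move=> on l2 ln; apply: smooth3_consecutive; [lia | |]; apply: factor_smooth; lia.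
Qed.

Lemma valz_c_le (p : nat) : prime p -> odd p -> (p.-1 * valz p c <= l.*2)%N.
Proof. by move=> pp op; have := factor_valz_le hn mq qh pp op; rewrite sq. Qed.

Lemma valz3_c_le : (4 * valz 3 c <= 3 * l + 1)%N.
Proof. by have := factor_valz3_le hn mq qh; rewrite sq. Qed.

Lemma absz_c_dvd (b : nat) : (0 < b)%N ->
  (forall p, prime p -> odd p -> (p <= l.*2.+1)%N -> (valz p c <= logn p b)%N) -> (absz c %| b)%N.
Proof.
move=> b0 H; have c0 : (0 < absz c)%N by rewrite absz_gt0 (factor_c_neq0 hn qh).
apply/dvdn_partP => // p; rewrite mem_primes => /and3P[pp _ pc].
by have [op ple _] := prime_dvd_c pp pc; rewrite p_part pfactor_dvdn // H.
Qed.

Lemma prime_ndvd_c (p : nat) : prime p -> (l.*2.+1 < p)%N -> ~~ (p %| absz c)%N.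
Proof. by move=> pp hp; apply/negP => pc; have [_ h1 _] := prime_dvd_c pp pc; clear -hp h1; lia. Qed.

Lemma odd1_dvd_const (p : nat) : l = 1%N -> prime p -> odd p -> ~~ (p %| absz c)%N ->
  (p %| n)%N -> (p %| absz (c - 1)%R)%N.
Proof.
move=> l1 pp op pc pn; have [q0 _ _ _ _] := Qpol_small.
by rewrite -q0; apply: factor_eq_const; rewrite ?subn0.
Qed.

Lemma odd1_dvd_sqr (p : nat) : l = 1%N -> prime p -> odd p -> ~~ (p %| absz c)%N ->
  (p %| n - 2)%N -> (p %| absz (c ^+ 2 + 3)%R)%N.
Proof.
move=> l1 pp op pc pn; have [_ [q20 q21] _ _ _] := Qpol_small.
have /dvdpP[g eg] := factor_redp hn qh pp op pc (isT : 2 != 1)%N hn pn.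
have := @monic_size2_root _ (redp 'F_p q) g _ (esym (etrans eg (mulrC _ _))).
rewrite !size_redp_monic ?monic_Qpol // sq l1 size_Qpol => /(_ _ _ _ _).
rewrite !coef_redp q20 q21 mul0r subr0 => /(_ (monic_redp _ mq) erefl (monic_redp _ (monic_Qpol _)) erefl).
have := dvdz_pcharf (pchar_Fp pp) (c ^+ 2 + 3); rewrite rmorphD /= rmorphXn /= dvdzE => -> ->.
by rewrite eqxx.
Qed.

Lemma absz_cases (x : int) (s : seq nat) (b : nat) : (0 < b)%N -> (absz x %| b)%N ->
  divisors b = s -> absz x \in s.
Proof. by move=> b0 xb <-; rewrite -dvdn_divisors. Qed.

(** Newton polygons give [c] among 1, -1, 3, -3. A prime of [n] not dividing [c] divides [c - 1], by
    [Q_0 = y + 1]; a prime of [n - 2] not dividing [c] divides [c ^+ 2 + 3], by [Q_2 = y^2 + 3].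
    Apart from powers of 2 these leave only 3, which cannot divide both. For [n = 3] the
    discriminant is negative. *)
Lemma no_factor_odd1 : odd n -> l = 1%N -> False.
Proof.
move=> on l1.
have : absz c \in [:: 1; 3]%N.
  apply: (@absz_cases c _ 3) => //; apply: absz_c_dvd => // p pp op ple.
  have -> : p = 3 by move: ple op (prime_gt1 pp); rewrite l1; clear; lia.
  have := valz3_c_le; rewrite l1 -[logn 3 3]/1%N.
  by move: (valz 3 c) => v; clear; lia.
move=> hc; have [n3|n3] := eqVneq n 3.
  have := @monic_size2_root _ q h (Qpol n) qh mq; rewrite sq l1 size_Qpol n3.
  have [_ _ -> _ _] := Qpol_small.
  have -> : (Qpol 3)`_1 = -2.
    by rewrite coef_Qpol // /wcoef /hcoef /= !dfactS dfact0.
  move=> /(_ erefl (monic_Qpol 3) erefl) e0.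
  have : 0 <= (c + 1) ^+ 2 by apply: sqr_ge0.
  have -> : (c + 1) ^+ 2 = c ^+ 2 - - 2 * c + 3 - 2 by ring.
  by rewrite e0.
have n5 : (5 <= n)%N by clear -hn on n3; lia.
have [p [pp pn]] : exists p, prime p /\ (p %| n - 2)%N.
  by exists (pdiv (n - 2)); rewrite pdiv_prime ?pdiv_dvd //; clear -n5; lia.
have op : odd p by apply: dvdn_odd pn _; clear -n5 on; lia.
have [r [pr rn]] : exists p, prime p /\ (p %| n)%N.
  by exists (pdiv n); rewrite pdiv_prime ?pdiv_dvd //; clear -n5; lia.
have or : odd r by apply: dvdn_odd rn _.
have r2 := odd_prime_gt2 or pr; have p2 := odd_prime_gt2 op pp.
have p3 : p != 3 -> (p %| absz (c ^+ 2 + 3)%R)%N.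
  move=> p3; apply: odd1_dvd_sqr => //; apply: prime_ndvd_c => //.
  by rewrite l1; clear -p3 p2 op; lia.
have r3 : r != 3 -> (r %| absz (c - 1)%R)%N.
  move=> r3; apply: odd1_dvd_const => //; apply: prime_ndvd_c => //.
  by rewrite l1; clear -r3 r2 or; lia.
have c1 : absz c = 1%N -> (p %| absz (c ^+ 2 + 3)%R)%N /\ (r %| absz (c - 1)%R)%N.
  move=> e; split; [apply: odd1_dvd_sqr | apply: odd1_dvd_const] => //.
    by rewrite e dvdn1; clear -p2; lia.
  by rewrite e dvdn1; clear -r2; lia.
have two x : prime x -> odd x -> (x %| 4)%N -> False.
  by move=> px ox; rewrite -[4%N]/(2 ^ 2)%N Euclid_dvdX // dvdn_prime2 // => /andP[/eqP e]; rewrite e in ox.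
move: hc; rewrite !inE => /orP[/eqP e|/eqP e].
  have [h1 h2] := c1 e; have c2 : c ^+ 2 = 1.
    have [->|->] : c = 1 \/ c = -1 by clear -e; lia.
      by rewrite expr1n.
    by rewrite sqrrN expr1n.
  by move: h1; rewrite c2; apply: two.
have [er|r3'] := eqVneq r 3.
  have [ep|p3'] := eqVneq p 3; first by move: pn rn; rewrite ep er; clear -n5; lia.
  have c9 : c ^+ 2 = 9.
    have [->|->] : c = 3 \/ c = -3 by clear -e; lia.
      by [].
    by [].
  have := p3 p3'; rewrite c9 -[absz _]/(4 * 3)%N Euclid_dvdM // => /orP[/two -/(_ pp op) //|].
  by rewrite dvdn_prime2 // (negbTE p3').
have := r3 r3'; have [->|->] : c = 3 \/ c = -3 by clear -e; lia.
  by move=> h1; apply: (two r) => //; apply: dvdn_trans h1 _.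
by move=> h1; apply: (two r).
Qed.

Lemma odd2_dvd_const (p n0 : nat) : l = 2 -> (2 <= n0 <= 3)%N -> (n0 <= n)%N ->
  prime p -> (5 < p)%N -> (p %| n - n0)%N -> (p %| absz (c - 3)%R)%N.
Proof.
move=> l2 hn0 n0n pp p5 pd; have [_ [q20 _] q30 _ _] := Qpol_small.
have op : odd p by case: (even_prime pp) => // e; rewrite e in p5.
have pc : ~~ (p %| absz c)%N by apply: prime_ndvd_c; rewrite ?l2.
have : n0 \in [:: 2; 3] by rewrite !inE; clear -hn0; lia.
rewrite !inE => /orP[/eqP e|/eqP e]; move: pd n0n; rewrite e => pd n0n.
  by rewrite -q20; apply: factor_eq_const.
by rewrite -q30; apply: factor_eq_const.
Qed.

Lemma odd2_ndvd_c3 (p : nat) : l = 2 -> (4 <= n)%N -> c = 3 -> prime p -> (3 < p)%N ->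
  ~~ (p %| n - 4)%N.
Proof.
move=> l2 n4 c3 pp p3; apply/negP => pd.
have op : odd p by case: (even_prime pp) => // e; rewrite e in p3.
have pc : ~~ (p %| absz c)%N.
  by rewrite c3; apply/negP => /dvdn_leq; clear -p3; lia.
have [_ _ _ [q40 q41 q42] _] := Qpol_small.
have /dvdpP[g eg] := factor_redp hn qh pp op pc (isT : 4 != 1)%N n4 pd.
have := @monic_size3_cofactor _ (redp 'F_p q) g _ (esym (etrans eg (mulrC _ _))).
rewrite !size_redp_monic ?monic_Qpol // sq l2 size_Qpol => /(_ _ _ _ _).
move=> /(_ (monic_redp _ mq) erefl (monic_redp _ (monic_Qpol _)) erefl) [b].
have i3 : (3 : int)%:~R = 3 :> 'F_p by rewrite (rmorph_nat _ 3).
have i5 : (5 : int)%:~R = 5 :> 'F_p by rewrite (rmorph_nat _ 5).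
rewrite !coef_redp q40 q41 q42 c3 rmorphN /= i3 i5; move: (q`_1)%:~R => a1 [e0 e1 e2].
have h0 : 3 * b + 5 = 0 by rewrite -e0 addNr.
have h1 : 3 + a1 * b - 5 = 0 by rewrite -e1 subrr.
have h2 : a1 = -5 - b by rewrite e2 addrK.
have : 32%:R = 0 :> 'F_p.
  (* Eliminating the unknowns from the three coefficient identities leaves the constant 32, so [p]
     would be 2. *)
  have -> : 32%:R = 9 * (3 + a1 * b - 5) + (3 * b + 5) * (3 * b + 10) :> 'F_p.
    by rewrite h2; ring.
  by rewrite h0 h1 mulr0 mul0r addr0.
move/eqP; rewrite -(dvdn_pcharf (pchar_Fp pp)) -[32%N]/(2 ^ 5)%N Euclid_dvdX // dvdn_prime2 //.
by move=> /andP[/eqP e]; rewrite e in op.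
Qed.

(** If [c != 3], then [c - 3] divides 72, which makes [n - 2] and [n - 3] 5-smooth. If [c = 3], then
    [n - 4], [n] and [n + 1] are powers of 3, 5 and 2, impossible modulo 4. *)
Lemma no_factor_odd2 : odd n -> l = 2 -> (l.*2 <= n./2.+1)%N -> False.
Proof.
move=> on l2 ln; have n7 : (7 <= n)%N by move: ln; rewrite l2; clear -on; lia.
have hc : absz c \in [:: 1; 3; 5; 15]%N.
  apply: (@absz_cases c _ 15) => //; apply: absz_c_dvd => // p pp op ple.
  have : p \in [:: 3; 4; 5] by rewrite !inE; move: ple op (prime_gt1 pp); rewrite l2; clear; lia.
  rewrite !inE => /or3P[] /eqP e; rewrite e //.
  - have := valz3_c_le; rewrite l2 -[logn 3 15]/1%N.
    by move: (valz 3 c) => v; clear; lia.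
  have := @valz_c_le 5 isT isT; rewrite l2 -[logn 5 15]/1%N.
  by move: (valz 5 c) => v; clear; lia.
have sA : smooth 5 n.+1 by apply: factor_smooth; clear -n7 l2; lia.
have sB : smooth 5 n by apply: factor_smooth; clear -n7 l2; lia.
have [c3|c3] := eqVneq c 3; last first.
  have sm n0 : (2 <= n0 <= 3)%N -> smooth 5 (n - n0).
    move=> hn0 p pp pd; rewrite leqNgt; apply/negP => p5.
    have := odd2_dvd_const l2 hn0 _ pp p5 pd => /(_ ltac:(clear -hn0 n7; lia)) h1.
    have : (p %| 72)%N.
      apply: dvdn_trans h1 _; move: hc c3; rewrite !inE.
      move: (c) => x; clear => hx x3.
      have : x \in [:: 1; -1; -3; 5; -5; 15; -15] by rewrite !inE; lia.
      by rewrite !inE => /or4P[|||/or4P[]] /eqP ->.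
    rewrite -[72%N]/(2 ^ 3 * 3 ^ 2)%N Euclid_dvdM // !Euclid_dvdX // !andbT !dvdn_prime2 //.
    by case/orP => /eqP e; rewrite e in p5.
  by apply: (no_smooth5 on) => //; apply: sm.
have sD : smooth 3 (n - 4).
  move=> p pp pd; rewrite leqNgt; apply/negP => p3.
  by have := odd2_ndvd_c3 l2 _ c3 pp p3; rewrite pd => /(_ ltac:(clear -n7; lia)).
have [x ex] := smooth3_odd (ltac:(clear -n7 on; lia) : odd (n - 4)) sD.
have d3 := pow3_gt1 ex ltac:(clear -n7; lia).
have [b eb] : exists b, n = (5 ^ b)%N.
  apply: prime_powP => [|r pr rn]; first by clear -n7; lia.
  have := sB r pr rn; have := dvdn_odd rn on; have := prime_gt1 pr.
  have : r != 3 by apply/eqP => e; move: rn; rewrite e; clear -d3 n7; lia.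
  clear; lia.
have b0 : (0 < b)%N by case: b eb => // e; rewrite e in n7.
have d5 : (5 %| n)%N by rewrite eb; case: (b) b0 => // b' _; rewrite expnS dvdn_mulr.
have [d ed] : exists d, n.+1 = (2 ^ d)%N.
  apply: smooth3_ndvd3 => //; first by clear -d3 n7; lia.
  by apply: smooth35 sA _; clear -d5; lia.
have n4 : (n %% 4 = 1)%N.
  by rewrite eb; elim: (b) => // b' IH; rewrite expnS -modnMmr IH.
case: d ed => [|[|d]]; first by clear -n7; lia.
  by rewrite expn1; clear -n7; lia.
by rewrite !expnS; clear -n4; lia.
Qed.

Lemma no_factor_odd3 : odd n -> l = 3 -> (l.*2 <= n./2.+1)%N -> False.
Proof.
move=> on l3 ln; have n11 : (10 < n)%N by move: ln; rewrite l3; clear -on; lia.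
have en : n = 27.
  by apply: smooth7_eq27 => //; apply: factor_smooth; clear -n11 l3; lia.
have [_ _ _ [q40 _ _] q50] := Qpol_small.
have pc p : prime p -> (7 < p)%N -> ~~ (p %| absz c)%N.
  by move=> pp hp; apply: prime_ndvd_c; rewrite ?l3.
(* [27 - 4 = 23] and [27 - 5 = 2 * 11]: the polynomials [Qpol 4] and [Qpol 5] both have degree 3,
   and determine [c] modulo 23 and 11. *)
have h1 : (23 %| absz (c + 5)%R)%N.
  rewrite -[5]opprK -[- 5]q40; apply: factor_eq_const; rewrite ?en ?l3 //.
  exact: pc.
have h2 : (11 %| absz (c + 15)%R)%N.
  rewrite -[15]opprK -[- 15]q50; apply: factor_eq_const; rewrite ?en ?l3 //.
  exact: pc.
have : absz c \in [:: 1; 3; 5; 7; 9; 15; 21; 35; 45; 63; 105; 315]%N.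
  apply: (@absz_cases c _ 315) => //; apply: absz_c_dvd => // p pp op ple.
  have : p \in [:: 3; 4; 5; 6; 7] by rewrite !inE; move: ple op (prime_gt1 pp); rewrite l3; clear; lia.
  rewrite !inE => /or4P[/eqP e|/eqP e|/eqP e|/orP[]/eqP e]; rewrite e //.
  - have := valz3_c_le; rewrite l3 -[logn 3 315]/2%N.
    by move: (valz 3 c) => v; clear; lia.
  - have := @valz_c_le 5 isT isT; rewrite l3 -[logn 5 315]/1%N.
    by move: (valz 5 c) => v; clear; lia.
  have := @valz_c_le 7 isT isT; rewrite l3 -[logn 7 315]/1%N.
  by move: (valz 7 c) => v; clear; lia.
by rewrite !inE; move: h1 h2; move: (c) => x; clear; lia.
Qed.

End NoFactor.

Lemma dfact_small : [/\ dfact 2 = 3, dfact 3 = 15, dfact 4 = 105 & dfact 5 = 945]%N.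
Proof. by rewrite !dfactS dfact0. Qed.

Lemma Qpol8_factor (q h : {poly int}) : q \is monic -> q * h = Qpol 8 ->
  (5 * valz 3 q`_0%R <= 3 * (size q).-1)%N.
Proof.
move=> mq qh; apply: (factor_valz_even (isT : 2 <= 8)%N mq qh) => // i hi.
have [d2 d3 d4 d5] := dfact_small.
have : i \in [:: 1; 2; 3; 4; 5]%N by rewrite !inE; clear -hi; lia.
by rewrite !inE => /or4P[|||/orP[]] /eqP ->; rewrite ?dfact1 ?d2 ?d3 ?d4 ?d5.
Qed.

(** Only [n = 8] remains. The Newton polygon at 3 has slope [3 / 5], so factors of degrees 2 and 3
    have constant terms of valuation at most 1 each, against a total of 3. *)
Lemma no_factor_even2 (n : nat) (q h : {poly int}) : (2 <= n)%N -> q \is monic ->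
  q * h = Qpol n -> ~~ odd n -> size q = 3 -> (4 <= n./2.+1)%N -> False.
Proof.
move=> hn mq qh on sq ln.
have en : n = 8 by apply: (even2_eq8 hn mq qh sq on).
move: qh; rewrite en => qh.
have mh : h \is monic by rewrite -(monicMl _ mq) qh monic_Qpol.
have hq : h * q = Qpol 8 by rewrite mulrC.
have sh : size h = 4.
  have := size_Qpol 8; rewrite -qh size_monicM ?monic_neq0 // sq /=; clear; lia.
have := Qpol8_factor mq qh; have := Qpol8_factor mh hq; rewrite sq sh /=.
have := Qpol0_neq0 (isT : 2 <= 8)%N; rewrite -qh coef0M mulf_eq0 negb_or => /andP[q0 h0].
have : valz 3 (q`_0 * h`_0)%R = 3%N.
  have [_ d3 _ _] := dfact_small.
  by rewrite -coef0M qh /valz absz_Qpol0_even // d3.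
rewrite valzM //; clear; move: (valz 3 _) (valz 3 _) => a b; lia.
Qed.

Theorem Qpol_no_factor (n : nat) (q h : {poly int}) : (2 <= n)%N -> q \is monic ->
  q * h = Qpol n -> (1 < size q)%N -> (size q <= size h)%N -> False.
Proof.
move=> hn mq qh q1 qleh.
have hnz : h != 0.
  by apply: contraTneq qleh => ->; rewrite size_poly0; clear -q1; lia.
have ss := size_Qpol n; rewrite -qh size_monicM // in ss.
have [l sq] : exists l, size q = l.+1 by exists (size q).-1; clear -q1; lia.
have ln : (l.*2 <= n./2.+1)%N by move: ss qleh; rewrite sq; clear; lia.
have l0 : (0 < l)%N by move: q1; rewrite sq.
have [l4|l4] := leqP 4 l; first exact: (no_factor_ge4 hn mq qh sq l4 ln).
case on : (odd n); case: l sq ln l0 l4 => [|[|[|[|l]]]] sq ln // _ _.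
- exact: (no_factor_odd1 hn mq qh sq).
- exact: (no_factor_odd2 hn mq qh sq).
- exact: (no_factor_odd3 hn mq qh sq).
- by apply: (no_factor_even1 hn mq qh sq); rewrite ?on.
- by apply: (no_factor_even2 hn mq qh); rewrite ?on.
by apply: (no_factor_even3 hn mq qh sq); rewrite ?on.
Qed.

(** * Irreducibility *)

Lemma int_mul1 (x y : int) : x * y = 1 -> x * x = 1 /\ y = x.
Proof.
move=> e; have : absz x = 1%N.
  by apply/eqP; rewrite -dvdn1 -[1%N]/(absz 1) -e abszM dvdn_mulr.
move=> ax; have ex : x = 1 \/ x = -1 by clear -ax; lia.
case: ex e => ->; rewrite ?mul1r ?mulN1r; first by move=> ->.
by move=> ey; split => //; rewrite -ey opprK.
Qed.

Lemma monic_factors (a b : {poly int}) : a * b \is monic ->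
  exists e : int, [/\ e * e = 1, e *: a \is monic, e *: b \is monic & (e *: a) * (e *: b) = a * b].
Proof.
rewrite monicE lead_coefM => /eqP /int_mul1[e1 e2]; exists (lead_coef a).
rewrite !monicE !lead_coefZ e2 e1 eqxx; split => //.
by rewrite -scalerAl -scalerAr scalerA e1 scale1r.
Qed.

Lemma Qpol_factor_size1 (n : nat) (u v : {poly int}) : (2 <= n)%N -> u * v = Qpol n ->
  (size u == 1%N) || (size v == 1%N).
Proof.
move=> hn uv; have muv : u * v \is monic by rewrite uv monic_Qpol.
have [e [e1 mu mv euv]] := monic_factors muv.
have e0 : e != 0 by apply: contra_eq_neq e1 => ->; rewrite mul0r eq_sym oner_neq0.
rewrite uv in euv; rewrite -(size_scale u e0) -(size_scale v e0).
apply/negPn/negP; rewrite negb_or => /andP[su sv].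
have u1 : (1 < size (e *: u))%N.
  by rewrite ltn_neqAle eq_sym su size_poly_gt0 monic_neq0.
have v1 : (1 < size (e *: v))%N.
  by rewrite ltn_neqAle eq_sym sv size_poly_gt0 monic_neq0.
case/orP: (leq_total (size (e *: u)) (size (e *: v))) => h.
  exact: (Qpol_no_factor hn mu euv u1 h).
by apply: (Qpol_no_factor hn mv _ v1 h); rewrite mulrC.
Qed.

(** The gcd of [F] and [Qpol n] is trivial or everything. If trivial, [F] is prime to [Qpol n ^+ 2],
    which it divides. Otherwise [Qpol n], being monic, divides [F] over the integers. *)
Lemma Qpol_dvd_or_size1 (n : nat) (F G : {poly int}) : (2 <= n)%N -> F * G = Qpol n ^+ 2 ->
  size F = 1%N \/ exists t, F = Qpol n * t.
Proof.
move=> hn FG; have mQ := monic_Qpol n.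
have [r er] := dvdpP_int (dvdp_gcdr F (Qpol n)).
have := Qpol_factor_size1 hn (esym er); rewrite size_zprimitive => /orP[hc|hr].
  left; have cFQ : coprimep F (Qpol n) by rewrite /coprimep.
  have cFQ2 : coprimep F (Qpol n ^+ 2) by rewrite coprimep_expr.
  have FQ2 : F %| Qpol n ^+ 2 by rewrite -FG dvdp_mulr.
  by have /coprimepP/(_ _ (dvdpp F) FQ2) := cFQ2; rewrite -size_poly_eq1 => /eqP.
right; have QF : Qpol n %| F.
  apply: dvdp_trans (dvdp_gcdl F (Qpol n)).
  have /size_poly1P[k k0 ek] := hr.
  rewrite [X in X %| _]er ek mulrC mul_polyC dvdpZl //.
  rewrite [X in _ %| X]zpolyEprim dvdpZr ?dvdpp // zcontents_eq0 gcdp_eq0.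
  by rewrite (negbTE (monic_neq0 mQ)) andbF.
by have [t et] := dvdpP_int QF; exists t; rewrite {1}et zprimitive_monic.
Qed.

(** This is the norm of [f] with respect to the substitution of [-x] for [x], written in
    [y = x^2]. *)
Lemma even_odd_norm (R : comNzRingType) (f : {poly R}) :
  f * (f \Po - 'X) = (even_poly f * even_poly f - 'X * (odd_poly f * odd_poly f)) \Po 'X^2.
Proof.
set E := even_poly f; set O := odd_poly f.
have ef : f = (E \Po 'X^2) + (O \Po 'X^2) * 'X by rewrite poly_even_odd.
have neg (A : {poly R}) : (A \Po 'X^2) \Po - 'X = A \Po 'X^2.
  by rewrite -comp_polyA comp_Xn_poly sqrrN.
rewrite {1 2}ef comp_polyD comp_polyM !neg comp_polyX comp_polyB !comp_polyM comp_polyX; ring.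
Qed.

(** For [n] odd, [p] occurs once in [n!!], as [3 p > n]. For [n] even, either [p = n + 1] or
    [p <= n - 3]; the prime [n - 1] is the one missing from [(n + 1) (n - 3)!!]. *)
Lemma logn_Qpol0 (n p : nat) : (2 <= n)%N -> prime p -> odd p -> (p <= n.+1)%N ->
  (n.+1 < p.*2)%N -> p != n.-1 -> logn p (absz (Qpol n)`_0) = 1%N.
Proof.
move=> hn pp op pn np pn1; have p0 := prime_gt0 pp; case on : (odd n).
  rewrite absz_Qpol0_odd // logn_dfact //.
  have -> : ((n./2.+1 + p./2) %/ p = 1)%N.
    have -> : (n./2.+1 + p./2 = 1 * p + (n./2.+1 + p./2 - p))%N by clear -on op pn hn; lia.
    by rewrite divnMDl // divn_small ?addn0 //; clear -on op pn np; lia.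
  by rewrite dfact1 logn1.
rewrite absz_Qpol0_even ?on // lognM ?dfact_gt0 // logn_dfact //.
have lpp : logn p p = 1%N by rewrite -{2}[p]expn1 pfactorK.
have [ep|ep] := eqVneq p n.+1.
  have -> : ((n./2.-1 + p./2) %/ p = 0)%N by rewrite divn_small //; clear -on hn ep; lia.
  by rewrite dfact0 logn1 -ep lpp.
have -> : ((n./2.-1 + p./2) %/ p = 1)%N.
  have -> : (n./2.-1 + p./2 = 1 * p + (n./2.-1 + p./2 - p))%N.
    by clear -on op pn hn pn1 ep; lia.
  by rewrite divnMDl // divn_small ?addn0 //; clear -on op pn np; lia.
rewrite dfact1 logn1 !addn0; have -> // : logn p n.+1 = 0%N.
apply/eqP; rewrite -leqn0 leqNgt logn_gt0 mem_primes pp /=.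
apply/negP => /dvdnP[k ek]; move: ek ep pn np; case: k => [|[|k]]; rewrite ?mul1n //.
  by move=> ->; rewrite eqxx.
by move=> ->; clear -p0; nia.
Qed.

Lemma Qpol0_not_square (n k : nat) : (2 <= n)%N -> absz (Qpol n)`_0 = (k * k)%N -> False.
Proof.
move=> hn ek.
have nop p : prime p -> odd p -> (p <= n.+1)%N -> (n.+1 < p.*2)%N -> p != n.-1 -> False.
  move=> pp op h1 h2 h3; have := logn_Qpol0 hn pp op h1 h2 h3.
  have k0 : (0 < k)%N.
    have := Qpol0_neq0 hn; rewrite -absz_gt0 ek; by case: (k).
  by rewrite ek lognM //; clear; lia.
have [n14|n14] := leqP 14 n.
  (* The largest [l] allowed by [l.*2 <= n./2.+1], at least 4 here. The Sylvester theorem then acts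
     as Bertrand's postulate: a multiple of [p > (n + 1) / 2] in the window is [p] itself, and the
     hole removes [n - 1]. *)
  pose l := (n./2.+1)./2.
  apply: (@not_smooth_window l.*2.-1 n.+1); try by rewrite /l; clear -n14; lia.
  move=> p i pp hi iN pi; rewrite leqNgt; apply/negP => hp.
  have lp : (n.+1 < p.*2)%N by move: hp; rewrite /l; clear -n14; lia.
  have op : odd p by case: (even_prime pp) => // e; move: hp; rewrite e /l; clear -n14; lia.
  have ei : i = p.
    have [t et] := dvdnP pi; case: t et => [|[|t]] et; rewrite et ?mul1n //.
      by move: hi; rewrite et /l; clear -n14; lia.
    have : (2 * p <= t.+2 * p)%N by rewrite leq_mul2r orbT.
    by move: hi lp; rewrite et; move: (t.+2 * p)%N => x; clear; lia.
  by apply: (nop p) => //; move: hi iN; rewrite ei; clear -n14; lia.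
have : n \in [:: 2; 3; 4; 5; 6; 7; 8; 9; 10; 11; 12; 13]%N.
  by rewrite !inE; clear -hn n14; lia.
have nop' : forall p, prime p -> [&& odd p, p <= n.+1, n.+1 < p.*2 & p != n.-1]%N -> False.
  by move=> p pp /and4P[]; apply: nop.
move: nop'; clear; rewrite !inE => nop.
by do ?(case/orP); move/eqP => e; subst n; first
  [ exact: (nop 3) | exact: (nop 5) | exact: (nop 7) | exact: (nop 11) | exact: (nop 13)].
Qed.

Lemma size_comp_X2 (R : idomainType) (A : {poly R}) : (size (A \Po 'X^2)).-1 = ((size A).-1).*2.
Proof. by rewrite size_comp_poly size_polyXn muln2. Qed.

Lemma comp_X2_inj (R : idomainType) (A B : {poly R}) : A \Po 'X^2 = B \Po 'X^2 -> A = B.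
Proof.
move=> e; apply/polyP => i.
have := congr1 (fun p : {poly R} => p`_(i * 2)) e.
by rewrite !coef_comp_poly_Xn // dvdn_mull // mulnK.
Qed.

(** The norms [F] and [G] of [f] and [g] are non-constant with product [Qpol n ^+ 2], so each is
    [Qpol n] up to sign; but [F] has constant term [f(0)^2]. *)
Lemma Qpol_X2_no_factor (n : nat) (f g : {poly int}) : (2 <= n)%N ->
  f \is monic -> g \is monic -> f * g = Qpol n \Po 'X^2 ->
  (1 < size f)%N -> (1 < size g)%N -> False.
Proof.
move=> hn mf mg fg sf sg.
have norm (a : {poly int}) : exists A : {poly int}, a * (a \Po - 'X) = A \Po 'X^2.
  by exists (even_poly a * even_poly a - 'X * (odd_poly a * odd_poly a)); apply: even_odd_norm.
have [F eF] := norm f; have [G eG] := norm g.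
have szF (a A : {poly int}) : (1 < size a)%N -> a * (a \Po - 'X) = A \Po 'X^2 -> size A != 1%N.
  move=> sa eA; have s1 : (size (a \Po - 'X)).-1 = (size a).-1.
    by rewrite size_comp_poly size_polyN size_polyX muln1.
  have a0 : a != 0 by rewrite -size_poly_gt0; apply: leq_trans sa.
  have a1 : a \Po - 'X != 0.
    by rewrite -size_poly_gt0; move: s1 sa; clear; lia.
  have := size_comp_X2 A; rewrite -eA size_mul //.
  by move: s1 sa; move: (size (a \Po - 'X)) (size a) (size A) => x y z; clear; lia.
have FG : F * G = Qpol n ^+ 2.
  apply: comp_X2_inj; rewrite comp_polyM -eF -eG mulrACA fg -comp_polyM fg.
  by rewrite -comp_polyA comp_Xn_poly sqrrN expr2 -comp_polyM.
have [hF|[t et]] := Qpol_dvd_or_size1 hn FG; first by have := szF _ _ sf eF; rewrite hF.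
have GF : G * F = Qpol n ^+ 2 by rewrite mulrC.
have [hG|[u eu]] := Qpol_dvd_or_size1 hn GF; first by have := szF _ _ sg eG; rewrite hG.
have tu : t * u = 1.
  have Q0 : Qpol n * Qpol n != 0 by rewrite mulf_neq0 ?monic_neq0 ?monic_Qpol.
  by apply: (mulfI Q0); rewrite mulr1 mulrACA -et -eu FG expr2.
have t1 : absz t`_0 = 1%N.
  have := congr1 absz (coef0M t u); rewrite tu coef1 abszM absz1 => /esym/eqP.
  by rewrite muln_eq1 => /andP[/eqP].
apply: (@Qpol0_not_square n (absz f`_0) hn).
rewrite -abszM; have -> : f`_0 * f`_0 = F`_0.
  have -> : F`_0 = (F \Po 'X^2).[0] by rewrite horner_comp hornerXn expr0n /= horner_coef0.
  by rewrite -eF hornerM horner_comp hornerN hornerX oppr0 !horner_coef0.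
by rewrite et coef0M abszM t1 muln1.
Qed.

Theorem mainTheorem3 (n : nat) (hn : (2 <= n)%N) : irreducible_Zx (Rem [:: n; 2%N]).
Proof.
rewrite Rem_two // drop_HeW2 //.
have mR : Qpol n \Po 'X^2 \is monic.
  by rewrite monicE lead_coef_comp ?size_polyXn // (monicP (monic_Qpol n)) lead_coefXn expr1n mul1r.
have sR : (size (Qpol n \Po 'X^2)).-1 = n./2.+1.*2 by rewrite size_comp_X2 size_Qpol.
split; first exact: monic_neq0.
  by rewrite poly_unitE; apply/negP => /andP[/eqP e _]; move: sR; rewrite e.
move=> a b e; have mab : a * b \is monic by rewrite -e.
have [s [s1 ma mb eab]] := monic_factors mab.
have us : s \is a GRing.unit by apply/unitrPr; exists s.
have s0 : s != 0 by apply: contraTneq us => ->; rewrite unitr0.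
have unitc (c : {poly int}) : s *: c \is monic -> ~~ (1 < size (s *: c))%N -> c \is a GRing.unit.
  move=> mc; rewrite -leqNgt => sc.
  have sc1 : size c = 1%N.
    by rewrite -(size_scale c s0); apply/eqP; rewrite eqn_leq sc size_poly_gt0 monic_neq0.
  rewrite poly_unitE sc1 eqxx /=; apply/unitrPr; exists s.
  by move/monicP: mc; rewrite lead_coefZ lead_coefE sc1 mulrC.
have [sa|sa] := boolP (1 < size (s *: a))%N; last by left; apply: unitc.
have [sb|sb] := boolP (1 < size (s *: b))%N; last by right; apply: unitc.
have efg : (s *: a) * (s *: b) = Qpol n \Po 'X^2 by rewrite eab -e.
by case: (Qpol_X2_no_factor hn ma mb efg sa sb).
Qed.
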